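(* Let $k,d\ge1$, $n\ge1$, $N=2^n$, and let $\mathbb{F}$ be a field with $\mathrm{char}(\mathbb{F})=0$ or $\mathrm{char}(\mathbb{F})\ge d^k$. Then there exists a $\mathrm{poly}(k,n)$-$\Sigma\Pi\Sigma$-succinct generator for the class of $N$-variate polynomials $F\in\mathbb{F}[X_1,\ldots,X_N]$ that can be written as $F=C(T_1,\ldots,T_M)$, where $C$ is a polynomial (circuit) of degree $\mathrm{poly}(N)$, each $T_i$ is a product of $d$ affine linear forms in $X_1,\ldots,X_N$, and the transcendence degree of $\{T_1,\ldots,T_M\}$ is at most $k$.
   Context: A set of polynomials $\{F_1,\ldots,F_r\}$ is algebraically independent if $H(F_1,\ldots,F_r)\not\equiv0$ for every non-zero $H\in\mathbb{F}[w_1,\ldots,w_r]$; the transcendence degree of a set of polynomials is the size of a maximal algebraically independent subset. Variables $X_1,\ldots,X_N$ are identified with subsets $S\subseteq[n]$ (equivalently multilinear monomials $x_S=\prod_{k\in S}x_k$ in $x_1,\ldots,x_n$) via $i-1=\sum_{k\in S}2^{k-1}$. A polynomial map $\mathcal{G}:\mathbb{F}^m\to\mathbb{F}^{2^n}$ is an $s$-$\Sigma\Pi\Sigma$-succinct generator for a class $\mathcal{D}$ of $N$-variate polynomials if (i) for every $\alpha\in\mathbb{F}^m$ the multilinear polynomial $\sum_{S}\mathcal{G}_S(\alpha)x_S$ is computed by a (multilinear) depth-3 $\Sigma\Pi\Sigma$ formula of size at most $s$, and (ii) for every $F\in\mathcal{D}$, $F\not\equiv0$ iff $F\circ\mathcal{G}\not\equiv0$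 as a polynomial in the seed variables. *)

(* Defs.v *)
From HB Require Import structures.
From mathcomp Require Import all_boot all_order all_algebra.
From mathcomp Require Import mpoly.
Set Implicit Arguments. Unset Strict Implicit. Unset Printing Implicit Defensive.
Import GRing.Theory.
Local Open Scope ring_scope.

Definition alg_indep (F : fieldType) (N r : nat) (T : 'I_r -> {mpoly F[N]}) :=
  forall H : {mpoly F[r]}, H != 0 -> H \mPo [tuple T i | i < r] != 0.

Definition trdeg_le (F : fieldType) (N M : nat) (T : 'I_M -> {mpoly F[N]})
  (k : nat) :=
  forall (r : nat) (f : 'I_r -> 'I_M), injective f -> alg_indep (T \o f) ->
    (r <= k)%N.

Definition deg_le (F : fieldType) (n : nat) (p : {mpoly F[n]}) (D : nat) :=
  (msize p <= D.+1)%N.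

Definition in_class (F : fieldType) (e k d n : nat) (P : {mpoly F[2 ^ n]}) :=
  exists (M : nat) (C : {mpoly F[M]}) (L : 'I_M -> 'I_d -> {mpoly F[2 ^ n]}),
    [/\ deg_le C ((2 ^ n) ^ e),
        (forall i j, deg_le (L i j) 1),
        trdeg_le (fun i => \prod_(j < d) L i j) k &
        P = C \mPo [tuple \prod_(j < d) L i j | i < M]].

Definition aff_form (F : fieldType) (n : nat) := (F * {ffun 'I_n -> F})%type.
Definition sps_formula (F : fieldType) (n : nat) := seq (seq (aff_form F n)).

Definition aff_eval (F : fieldType) (n : nat) (l : aff_form F n) : {mpoly F[n]} :=
  l.1%:MP + \sum_(i < n) l.2 i *: 'X_i.

Definition sps_eval (F : fieldType) (n : nat) (f : sps_formula F n) : {mpoly F[n]} :=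
  \sum_(g <- f) \prod_(l <- g) aff_eval l.

(* size: one top gate, one node per product gate, and for each affine form
   one node plus one per nonzero linear coefficient *)
Definition sps_size (F : fieldType) (n : nat) (f : sps_formula F n) : nat :=
  (1 + \sum_(g <- f) (1 + \sum_(l <- g) (1 + #|[set i | l.2 i != 0%R]|)))%N.

Definition aff0 (F : fieldType) (n : nat) : aff_form F n := (0, [ffun => 0]).

Definition sps_multilinear (F : fieldType) (n : nat) (f : sps_formula F n) :=
  forall g, g \in f -> forall j1 j2, (j1 < size g)%N -> (j2 < size g)%N ->
    j1 != j2 -> forall i : 'I_n,
      (nth (aff0 F n) g j1).2 i = 0 \/ (nth (aff0 F n) g j2).2 i = 0.

Definition xS (F : fieldType) (n : nat) (S : {set 'I_n}) : {mpoly F[n]} :=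
  \prod_(k in S) 'X_k.

(* subset S <-> variable index sum_{k in S} 2^k (0-based version of
   i - 1 = sum_{k in S} 2^(k-1)) *)
Definition set_index (n : nat) (S : {set 'I_n}) : nat := (\sum_(k in S) 2 ^ k)%N.

Definition sps_succinct (F : fieldType) (n m : nat)
  (G : (2 ^ n).-tuple {mpoly F[m]}) (s : nat) :=
  forall alpha : 'I_m -> F, exists f : sps_formula F n,
    [/\ sps_multilinear f, (sps_size f <= s)%N &
        sps_eval f = \sum_(S : {set 'I_n}) (nth 0 G (set_index S)).@[alpha] *: xS F S].

Definition generator_for (F : fieldType) (n m : nat)
  (G : (2 ^ n).-tuple {mpoly F[m]}) (P : {mpoly F[2 ^ n]} -> Prop) :=
  forall Q, P Q -> (Q != 0 <-> Q \mPo G != 0).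

(* Main.v *)
Require Import Defs.
From HB Require Import structures.
From mathcomp Require Import all_boot all_order all_algebra.
From mathcomp Require Import mpoly ring zify.
From Stdlib Require Import Classical.
Set Implicit Arguments. Unset Strict Implicit. Unset Printing Implicit Defensive.
Import Order.TTheory GRing.Theory Num.Theory.
Local Open Scope ring_scope.

(** The generator is [G_a = \sum_(j <= k) z_j t_j^a], whose generating polynomial
    is [\sum_j z_j \prod_l (1 + t_j^(2^l) x_l)]. It is enough that [G] keeps a
    transcendence basis [T_1, .., T_r] of the products independent: a nonzero [Q]
    algebraic over the [T_i] divides some nonzero [A(T_1, .., T_r)].

    Independence is transported with valuations instead of Jacobians, which makes
    the argument characteristic free. Extend to [F(X)] a valuation for which the
    monomials in the [T_i] have distinct values. The values of the affine forms
    (with the form [1] at infinity) filter them by a chain of flats, and the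
    multiplicities of the [T_i] along these flats have rank [r]. In such a chain a
    flat of rank at least two more than its predecessor can be replaced by one of
    rank one more, because these partition the difference; hence there is a
    chain of flats of rank at most [r]. Any flat of rank at most [k] is cut out,
    among the finitely many forms, by a point in the span of [k + 1] generic
    points of the moment curve (a determinant), so [G] specializes to a point whose
    leading monomials on the forms realize the whole chain, and the monomials in
    the [T_i] then have distinct leading monomials. *)

(** * Extension of valuations *)

(** A subring [B] with a proper ideal [J], approximating a valuation ring and its maximal ideal.
    Only finitely many elements have to be compared, so no maximal such pair is constructed. *)
Record ring_ideal (K : fieldType) (B J : K -> Prop) : Prop := RingIdeal {
  ri1 : B 1;
  riN : forall x, B x -> B (- x);
  riD : forall x y, B x -> B y -> B (x + y);
  riM : forall x y, B x -> B y -> B (x * y);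
  riJ0 : J 0;
  riJD : forall x y, J x -> J y -> J (x + y);
  riJM : forall x y, B x -> J y -> J (x * y);
  riJB : forall x, J x -> B x;
  riJ1 : ~ J 1 }.

(** Serves for both components: [adjoin B x] is the ring [B[x]], and [adjoin J x] is the ideal of
    [B[x]] generated by [J]. *)
Definition adjoin (K : fieldType) (P : K -> Prop) (x y : K) :=
  exists2 p : {poly K}, (forall i, P p`_i) & y = p.[x].

Section Chevalley.
Variable K : fieldType.
Implicit Types (B J : K -> Prop) (x y : K).

Lemma ri0 B J : ring_ideal B J -> B 0.
Proof. by move=> h; apply: (riJB h); apply: riJ0 h. Qed.

Lemma adjoin_sub (P : K -> Prop) x y : P 0 -> P y -> adjoin P x y.
Proof.
move=> P0 Py; exists y%:P; last by rewrite hornerC.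
by move=> i; rewrite coefC; case: ifP.
Qed.

Lemma adjoin_self B J x : ring_ideal B J -> adjoin B x x.
Proof.
move=> h; exists 'X; last by rewrite hornerX.
move=> i; rewrite coefX; case: eqP => _; [exact: ri1 h | exact: ri0 h].
Qed.

Lemma ring_ideal_adjoin B J x :
  ring_ideal B J -> ~ adjoin J x 1 -> ring_ideal (adjoin B x) (adjoin J x).
Proof.
move=> h n1; split=> //.
- exact: adjoin_sub (ri0 h) (ri1 h).
- move=> _ [p hp ->]; exists (- p); last by rewrite hornerN.
  by move=> i; rewrite coefN; apply: (riN h).
- move=> _ _ [p hp ->] [q hq ->]; exists (p + q); last by rewrite hornerD.
  by move=> i; rewrite coefD; apply: (riD h).
- move=> _ _ [p hp ->] [q hq ->]; exists (p * q); last by rewrite hornerM.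
  move=> i; rewrite coefM; apply: (@big_ind _ B); first exact: ri0 h.
    exact: (riD h).
  by move=> j _; apply: (riM h).
- exact: adjoin_sub (riJ0 h) (riJ0 h).
- move=> _ _ [p hp ->] [q hq ->]; exists (p + q); last by rewrite hornerD.
  by move=> i; rewrite coefD; apply: (riJD h).
- move=> _ _ [p hp ->] [q hq ->]; exists (p * q); last by rewrite hornerM.
  move=> i; rewrite coefM; apply: (@big_ind _ J); first exact: riJ0 h.
    exact: (riJD h).
  by move=> j _; apply: (riJM h).
- by move=> _ [p hp ->]; exists p => // i; apply: (riJB h).
Qed.

(* A relation [1 = p(x)] of degree at least that of [1 = q(1/x)], both with
   coefficients in [J], can be shortened: multiply the former by [1 - q_0] and
   rewrite its leading term with the latter. *)
Lemma adjoin_or_inv B J x : ring_ideal B J -> x != 0 ->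
  ~ adjoin J x 1 \/ ~ adjoin J x^-1 1.
Proof.
move=> h x0; apply: NNPP => /not_or_and [/NNPP [p hp p1] /NNPP [q hq q1]].
have [s] := ubnP (size p + size q).
elim: s => // s IHs in x x0 p q hp hq p1 q1 *.
wlog lqp : x x0 p q hp hq p1 q1 / (size q <= size p)%N.
  move=> hw; case: (leqP (size q) (size p)) => [|/ltnW] hs; first exact: hw p1 q1 hs.
  rewrite addnC; apply: (hw x^-1 _ q p) => //; first by rewrite invr_eq0.
  by rewrite invrK.
rewrite ltnS => hs.
case E : (size q) => [|m].
  by move/eqP: E; rewrite size_poly_eq0 => /eqP q0; move/eqP: q1; rewrite q0 horner0 oner_eq0.
case: m E => [|m] E.
  move/eqP: E => /size_poly1P [c _ qc]; apply: (riJ1 h).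
  by rewrite q1 qc hornerC; have := hq 0%N; rewrite qc coefC.
set n := (size p).-1.
have sp : size p = n.+1 by rewrite /n prednK //; apply: leq_trans lqp; rewrite E.
have mn : (m.+1 <= n)%N by rewrite -ltnS -sp -E.
(* [r] takes the value [x^n (q(1/x) - q_0)] at [x] and has degree below [n]; it stands in for
   [(1 - q_0) x^n]. *)
pose r := \sum_(j < m.+1) q`_j.+1 *: 'X^(n - j.+1).
have rx : r.[x] = (1 - q`_0) * x ^+ n.
  rewrite [1 in RHS]q1 [q.[_]]horner_coef E big_ord_recl /= expr0 mulr1 addrAC subrr add0r.
  rewrite /r horner_sum mulr_suml; apply: eq_bigr => j _.
  rewrite hornerZ hornerXn -mulrA; congr (_ * _); rewrite exprVn mulrC expfB_cond //.
  by rewrite (negPf x0) /=; apply: leq_trans mn; rewrite ltn_ord.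
pose p' := \poly_(i < n) p`_i.
have px : p.[x] = p'.[x] + p`_n * x ^+ n.
  by rewrite horner_coef sp big_ord_recr /= horner_poly.
pose p2 := (q`_0)%:P + (1 - q`_0) *: p' + p`_n *: r.
have B1 : B (1 - q`_0) by apply: (riD h) (ri1 h) (riN h (riJB h (hq _))).
have hp2 i : J p2`_i.
  rewrite !coefD !coefZ; apply: (riJD h); first apply: (riJD h).
  - by rewrite coefC; case: ifP => _; [exact: hq|exact: riJ0 h].
  - by apply: (riJM h) => //; rewrite coef_poly; case: ifP => _; [exact: hp|exact: riJ0 h].
  - apply: (riJM h); first exact/(riJB h)/hp.
    rewrite coef_sum; apply: (@big_ind _ J); [exact: riJ0 h|exact: (riJD h)|].
    move=> j _; rewrite coefZ coefXn; case: eqP => _; rewrite ?mulr1 ?mulr0 //.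
    exact: riJ0 h.
have p2x : 1 = p2.[x].
  rewrite !hornerD !hornerZ hornerC rx mulrCA -addrA -mulrDr -px -p1.
  by rewrite mulr1 addrC subrK.
have sp2 : (size p2 <= n)%N.
  apply: leq_trans (size_polyD _ _) _; rewrite geq_max; apply/andP; split.
    apply: leq_trans (size_polyD _ _) _; rewrite geq_max; apply/andP; split.
      by apply: leq_trans (size_polyC_leq1 _) _; apply: leq_trans mn.
    by apply: leq_trans (size_scale_leq _ _) _; apply: size_poly.
  apply: leq_trans (size_scale_leq _ _) _.
  apply: leq_trans (size_sum _ _ _) _; apply/bigmax_leqP => j _.
  apply: leq_trans (size_scale_leq _ _) _; rewrite size_polyXn.
  by rewrite ltn_subrL /=; apply: leq_trans mn.
apply: (IHs x x0 p2 q) => //; apply: leq_trans hs.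
by rewrite sp addSn ltnS leq_add2r.
Qed.

(** Finite form of Chevalley's extension theorem: for each element of the list in turn, adjoin it or
    its inverse, whichever keeps the ideal proper. *)
Lemma chevalley_seq B J (s : seq K) : ring_ideal B J -> {in s, forall x, x != 0} ->
  exists B' J', [/\ ring_ideal B' J', (forall x, B x -> B' x),
     (forall x, J x -> J' x) & {in s, forall x, B' x \/ B' x^-1}].
Proof.
move=> h; elim: s => [|x s IHs] nz; first by exists B, J; split.
have [|B' [J' [h' BB JJ hs]]] := IHs; first by move=> y ys; apply: nz; rewrite inE ys orbT.
have x0 : x != 0 by apply: nz; rewrite inE eqxx.
have aux y : ~ adjoin J' y 1 -> y = x \/ y = x^-1 ->
   exists B' J', [/\ ring_ideal B' J', (forall x, B x -> B' x),
     (forall x, J x -> J' x) & {in x :: s, forall x, B' x \/ B' x^-1}].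
  move=> n1 hy; exists (adjoin B' y), (adjoin J' y); split.
  - exact: ring_ideal_adjoin.
  - by move=> z /BB; apply: adjoin_sub; apply: ri0 h'.
  - by move=> z /JJ; apply: adjoin_sub; apply: riJ0 h'.
  - move=> z; rewrite inE => /orP [/eqP ->|/hs].
      by case: hy => <-; [left|right]; apply: adjoin_self h'.
    by case=> hz; [left|right]; apply: adjoin_sub hz; apply: ri0 h'.
by case: (adjoin_or_inv h' x0) => /aux; apply; [left|right].
Qed.

End Chevalley.

(** * Chains of flats *)

Section Flats.
Variables (F : fieldType) (m : nat) (I : finType) (v : I -> 'rV[F]_m).
Implicit Types (S U V : {set I}).

Definition vspan S : 'M[F]_m := (\sum_(i in S) <<v i>>)%MS.
Definition vrank S := \rank (vspan S).
Definition flat S := forall i, (v i <= vspan S)%MS -> i \in S.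
Definition flat_closure S : {set I} := [set i | (v i <= vspan S)%MS].

Lemma mem_vspan S i : i \in S -> (v i <= vspan S)%MS.
Proof. by move=> iS; rewrite (sumsmx_sup i) // genmxE. Qed.

Lemma vspan_subP k S (A : 'M_(k, m)) :
  reflect (forall i, i \in S -> (v i <= A)%MS) (vspan S <= A)%MS.
Proof.
apply: (iffP sumsmx_subP) => h i iS; have := h i iS; by rewrite genmxE.
Qed.

Lemma vspanS S U : S \subset U -> (vspan S <= vspan U)%MS.
Proof. by move=> /subsetP SU; apply/vspan_subP => i /SU; apply: mem_vspan. Qed.

Lemma vspan_closure S : (vspan (flat_closure S) :=: vspan S)%MS.
Proof.
apply/eqmxP/andP; split; first by apply/vspan_subP => i; rewrite inE.
by apply: vspanS; apply/subsetP => i iS; rewrite inE mem_vspan.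
Qed.

Lemma flat_flat_closure S : flat (flat_closure S).
Proof. by move=> i; rewrite vspan_closure inE. Qed.

Lemma sub_flat_closure S : S \subset flat_closure S.
Proof. by apply/subsetP => i iS; rewrite inE mem_vspan. Qed.

Lemma flat_closure_min S U : flat U -> S \subset U -> flat_closure S \subset U.
Proof.
move=> fU SU; apply/subsetP => i; rewrite inE => h; apply: fU.
exact: submx_trans h (vspanS SU).
Qed.

Lemma vrank0 : vrank set0 = 0%N.
Proof. by rewrite /vrank /vspan big_set0 mxrank0. Qed.

Lemma flat0 : (forall i, v i != 0) -> flat set0.
Proof. by move=> nz i; rewrite /vspan big_set0 submx0 (negPf (nz i)). Qed.

Lemma vspanU1 S x : (vspan (x |: S) :=: vspan S + v x)%MS.
Proof.
apply/eqmxP/andP; split.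
  apply/vspan_subP => i /setU1P [->|iS]; first exact: addsmxSr.
  by apply: submx_trans (addsmxSl _ _); apply: mem_vspan.
rewrite addsmx_sub vspanS ?subsetUr //=.
by apply: mem_vspan; rewrite setU11.
Qed.

Lemma vrankU1 S x : flat S -> x \notin S -> vrank (x |: S) = (vrank S).+1.
Proof.
move=> fS xS; apply/eqP; rewrite eqn_leq; apply/andP; split.
  rewrite /vrank vspanU1; apply: leq_trans (mxrank_adds_leqif _ _).1 _.
  by rewrite -[X in (_ <= X)%N]addn1 leq_add2l rank_leq_row.
rewrite ltn_neqAle mxrankS ?vspanS ?subsetUr // andbT.
apply: contra xS => /eqP h; apply: fS.
have := mxrank_leqif_sup (vspanS (subsetUr [set x] S)).
rewrite /vrank in h; move=> /leqifP; case: ifP => [hs _|_]; last by rewrite h ltnn.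
by apply: submx_trans hs; rewrite mem_vspan // setU11.
Qed.

(* Exchange property: the flats one rank above [S] partition the complement. *)
Lemma flat_closure_exchange S x y : flat S -> x \notin S -> y \notin S ->
  y \in flat_closure (x |: S) -> flat_closure (y |: S) = flat_closure (x |: S).
Proof.
move=> fS xS yS yx.
have sub : flat_closure (y |: S) \subset flat_closure (x |: S).
  apply: flat_closure_min; first exact: flat_flat_closure.
  rewrite subUset sub1set yx /=.
  by apply: subset_trans (sub_flat_closure _); apply: subsetUr.
apply/eqP; rewrite eqEsubset sub /=; apply: flat_closure_min.
  exact: flat_flat_closure.
have := mxrank_leqif_sup (vspanS sub); rewrite !vspan_closure.
have := vrankU1 fS xS; have := vrankU1 fS yS; rewrite /vrank => -> ->.
move=> /leqifP; case: ifP => [hs _|_]; last by rewrite ltnn.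
apply: subset_trans (sub_flat_closure _) _.
by apply/subsetP => i; rewrite !inE => h; apply: submx_trans hs.
Qed.

(** * Weights on flags and minimal separating flags *)

Section Weights.
Variables (r : nat) (w : I -> 'cV[int]_r).

Definition weight S := \sum_(i in S) w i.
(** Equivalently, the weights of the members have rank [r] over the rationals. Integer rows are used
    because they will be differences of exponents. *)
Definition separating (s : {set {set I}}) := forall n : 'rV[int]_r,
  (forall U, U \in s -> n *m weight U = 0) -> n = 0.
Definition flag (s : {set {set I}}) := (forall U, U \in s -> flat U) /\
  (forall U V, U \in s -> V \in s -> (U \subset V) || (V \subset U)).

(** By the exchange property the closures of [x |: S], for [x] in [U :\: S], cut [U :\: S] into
    disjoint pieces. If [n] killed the weight of [S] and of every such closure, it would kill the
    weight of [U]. *)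
Lemma weight_refine (n : 'rV[int]_r) U S : flat S -> flat U -> S \subset U ->
  n *m weight S = 0 -> n *m weight U != 0 ->
  exists2 x, x \in U :\: S & n *m weight (flat_closure (x |: S)) != 0.
Proof.
move=> fS fU SU nS nU; apply: NNPP => hn.
have hx x : x \in U :\: S -> n *m weight (flat_closure (x |: S)) = 0.
  by move=> xU; apply/eqP; apply: contraT => h; case: hn; exists x.
have wD V : S \subset V -> n *m weight V = n *m \sum_(i in V :\: S) w i.
  move=> SV; rewrite /weight (big_setID S) /= (setIidPr SV) mulmxDr.
  by rewrite -/(weight S) nS add0r.
move/eqP: nU; apply; rewrite wD // (partition_big (fun x => flat_closure (x |: S)) predT) //=.
rewrite mulmx_sumr big1 // => A _.
case: (pickP (fun x => (x \in U :\: S) && (flat_closure (x |: S) == A))) => [x|h0]; last first.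
  by rewrite big_pred0 // mulmx0.
move=> /andP[xUS /eqP xA].
have SA : S \subset A.
  by rewrite -xA; apply: subset_trans (sub_flat_closure _); apply: subsetUr.
have := hx x xUS; rewrite xA wD // => <-; congr (_ *m _); apply: eq_bigl => y.
move: xUS; rewrite !inE => /andP[xS xU].
apply/andP/andP => [[/andP[yS yU] /eqP <-]|[yS yA]].
  by split => //; apply: (subsetP (sub_flat_closure _)); rewrite setU11.
split; last by rewrite (flat_closure_exchange fS xS yS) ?xA.
rewrite yS /=; move: yA; rewrite -xA; apply: subsetP.
by apply: flat_closure_min => //; rewrite subUset sub1set xU.
Qed.

(** The successor makes the size drop whenever a member is removed, even one of rank zero. *)
Definition flag_size (s : {set {set I}}) := (\sum_(U in s) (vrank U).+1)%N.

Lemma minimal_flag (s : {set {set I}}) : flag s -> separating s ->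
  exists2 t, flag t /\ separating t &
    forall t', flag t' -> separating t' -> (flag_size t <= flag_size t')%N.
Proof.
have [b] := ubnP (flag_size s); elim: b => // b IHb in s *.
rewrite ltnS => hs fs ss.
case: (classic (exists2 t, flag t /\ separating t & (flag_size t < flag_size s)%N)).
  by move=> [t [ft st] lt]; apply: (IHb t) => //; apply: leq_trans hs.
move=> hn; exists s => // t ft st; rewrite leqNgt; apply/negP => lt.
by apply: hn; exists t.
Qed.

(** Without [U] the flag is smaller, hence no longer separating. A row witnessing this kills all
    other members, so it cannot kill [U]. *)
Lemma minimal_flag_dual s : flag s -> separating s ->
  (forall t, flag t -> separating t -> (flag_size s <= flag_size t)%N) ->
  forall U, U \in s -> exists n : 'rV[int]_r,
    n *m weight U != 0 /\ forall V, V \in s -> V != U -> n *m weight V = 0.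
Proof.
move=> [fs cs] ss hmin U Us.
have fD : flag (s :\ U).
  by split=> [V|V W]; rewrite !inE => /andP[_ ?]; [|move=> /andP[_ ?]]; auto.
have nD : ~ separating (s :\ U).
  move=> /(hmin _ fD); rewrite /flag_size (big_setD1 U Us) /=.
  by rewrite addSn ltnNge leq_addl.
have [n hnn] := not_all_ex_not _ _ nD; have {hnn} [hn n0] := imply_to_and _ _ hnn.
exists n; split; last by move=> V Vs VU; apply: hn; rewrite !inE VU.
apply/eqP => nU; apply: n0; apply: ss => V Vs.
by case: (eqVneq V U) => [->//|VU]; apply: hn; rewrite !inE VU.
Qed.

(** The dual rows times the weights form an invertible diagonal matrix that factors through
    dimension [r]. *)
Lemma minimal_flag_card s : flag s -> separating s ->
  (forall t, flag t -> separating t -> (flag_size s <= flag_size t)%N) ->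
  (#|s| <= r)%N.
Proof.
move=> fs ss hmin; have hd := minimal_flag_dual fs ss hmin.
have hd' (i : 'I_#|s|) : exists n : 'rV[int]_r,
    n *m weight (enum_val i) != 0 /\ forall j, j != i -> n *m weight (enum_val j) = 0.
  have [n [n1 n2]] := hd _ (enum_valP i); exists n; split=> // j ji.
  by apply: n2 (enum_valP j) _; rewrite (inj_eq enum_val_inj).
have [n hn] := fin_all_exists hd'.
pose P : 'M[rat]_(#|s|, r) := map_mx intr (\matrix_i n i).
pose Q : 'M[rat]_(r, #|s|) := map_mx intr (\matrix_(i, j) weight (enum_val j) i 0).
have PQ : P *m Q = diag_mx (\row_i ((n i *m weight (enum_val i)) 0 0)%:~R).
  rewrite -map_mxM; apply/matrixP => i j; rewrite !mxE.
  have -> : \sum_j0 (\matrix_i0 n i0) i j0 * (\matrix_(i0, j1) weight (enum_val j1) i0 0) j0 j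
     = (n i *m weight (enum_val j)) 0 0.
    by rewrite !mxE; apply: eq_bigr => k _; rewrite !mxE.
  case: eqVneq => [->|ij]; first by rewrite mulr1n mxE.
  by rewrite (hn i).2 1?eq_sym // mxE mulr0n.
have : row_free (P *m Q).
  rewrite row_free_unit PQ unitmxE det_diag unitfE prodf_seq_neq0.
  apply/allP => i _ /=; rewrite mxE intr_eq0; have [h _] := hn i.
  apply: contra h => /eqP h; apply/eqP/matrixP => a b.
  by rewrite !ord1 h mxE.
rewrite /row_free => /eqP <-; apply: leq_trans (mxrankM_maxl _ _) _.
exact: rank_leq_col.
Qed.

(** Induction along the flag. If the bound first fails at [U], the rank jumps by at least two from
    the predecessor [S] of [U]; then [U] can be replaced by a flat of rank one more than [S], which
    contradicts minimality. *)
Lemma minimal_flag_rank s : (forall i, v i != 0) -> flag s -> separating s ->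
  (forall t, flag t -> separating t -> (flag_size s <= flag_size t)%N) ->
  forall U, U \in s -> (vrank U <= #|[set V in s | V \subset U]|)%N.
Proof.
move=> nz fs ss hmin U; have hd := minimal_flag_dual fs ss hmin.
have [b] := ubnP #|U|; elim: b => // b IHb in U *; rewrite ltnS => hU Us.
have [ffs cs] := fs.
(* In a chain this union is the largest member strictly inside [U], or empty if there is none. *)
pose S := \bigcup_(V in s | V \proper U) V.
have SU : S \subset U by apply/bigcupsP => V /andP[_ /proper_sub].
have subS V : V \in s -> V \proper U -> V \subset S.
  by move=> Vs VU; apply: bigcup_sup; rewrite Vs.
have hS : S = set0 \/ S \in s /\ S \proper U.
  case: (pickP (fun V => (V \in s) && (V \proper U))) => [V0 hV0|h0]; last first.
    by left; rewrite /S big_pred0.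
  right; pose W := [arg max_(V > V0 | (V \in s) && (V \proper U)) #|V|].
  suff -> : S = W by rewrite /W; case: arg_maxnP => // V /andP[].
  rewrite /W; case: arg_maxnP => // V /andP[Vs VU] hV.
  apply/eqP; rewrite eqEsubset subS // andbT; apply/bigcupsP => V' hV'.
  have /andP[V's _] := hV'.
  case/orP: (cs _ _ V's Vs) => // VV'.
  by have /eqP <- : V == V' by rewrite eqEcard VV'; apply: hV.
have fS : flat S by case: hS => [->|[/ffs]//]; exact: flat0.
have cS : ((vrank S).+1 <= #|[set V in s | V \subset U]|)%N.
  rewrite (cardsD1 U) !inE Us subxx add1n ltnS.
  case: hS => [->|[Ss SpU]]; first by rewrite vrank0.
  apply: leq_trans (IHb S _ Ss) _; first by apply: leq_trans hU; apply: proper_card.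
  apply: subset_leq_card; apply/subsetP => V; rewrite !inE => /andP[-> VS].
  rewrite (subset_trans VS SU) !andbT; apply: contraTneq VS => ->.
  by rewrite proper_subn.
rewrite leqNgt; apply/negP => hlt.
have hr : ((vrank S).+1 < vrank U)%N by apply: leq_ltn_trans hlt.
have [n [nU nO]] := hd U Us.
have nS : n *m weight S = 0.
  case: hS => [->|[Ss SpU]]; first by rewrite /weight big_set0 mulmx0.
  by apply: nO => //; apply: contraTneq SpU => ->; rewrite properxx.
have [x] := weight_refine fS (ffs _ Us) SU nS nU.
rewrite !inE => /andP[xS xU]; set E := flat_closure _ => nE.
have fE : flat E by apply: flat_flat_closure.
have rE : vrank E = (vrank S).+1 by rewrite /vrank vspan_closure -(vrankU1 fS xS).
have EU : E \subset U.
  by apply: flat_closure_min; [exact: ffs|rewrite subUset sub1set xU].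
have SE : S \subset E by apply: subset_trans (sub_flat_closure _); apply: subsetUr.
have ED : E \notin s :\ U.
  rewrite !inE; apply/negP => /andP[EnU Es].
  by move: nE; rewrite nO ?eqxx.
have /(hmin _) hm : flag (E |: s :\ U).
  have cE V : V \in s :\ U -> (E \subset V) || (V \subset E).
    rewrite !inE => /andP[VU Vs]; case/orP: (cs _ _ Us Vs) => h.
      by rewrite (subset_trans EU h).
    rewrite [V \subset E](subset_trans _ SE) ?orbT // subS //.
    by rewrite properEneq VU.
  split=> [V|V W].
    by case/setU1P => [->//|]; rewrite !inE => /andP[_ /ffs].
  case/setU1P => [->|hV]; case/setU1P => [->|hW]; rewrite ?subxx //.
  - exact: cE.
  - by rewrite orbC cE.
  - by move: hV hW; rewrite !inE => /andP[_ ?] /andP[_ ?]; apply: cs.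
(* A row [n'] killing the other members is proportional to the dual row [n], since
   [a *: n' - b' *: n] kills all of [s]. As [n] does not kill [E] and [n'] does, [n'] vanishes. *)
have sE : separating (E |: s :\ U).
  move=> n' hn'.
  pose a := (n *m weight U) 0 0; pose b' := (n' *m weight U) 0 0.
  have a0 : a != 0.
    apply: contra nU => /eqP h; apply/eqP/matrixP => i j; by rewrite !ord1 -/a h mxE.
  have h1 : a *: n' - b' *: n = 0.
    apply: ss => V Vs; rewrite mulmxBl -!scalemxAl.
    case: (eqVneq V U) => [->|VU].
      by rewrite [n *m _]mx11_scalar [n' *m _]mx11_scalar !scale_scalar_mx mulrC subrr.
    by rewrite hn' ?nO ?scaler0 ?subrr // !inE VU Vs orbT.
  have : (a *: n' - b' *: n) *m weight E = 0 by rewrite h1 mul0mx.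
  rewrite mulmxBl -!scalemxAl hn' ?setU11 // scaler0 sub0r => /eqP.
  rewrite oppr_eq0 => /eqP h2.
  have b0 : b' = 0.
    apply/eqP; apply: contraT => b0; case/eqP: nE.
    apply/matrixP => i j; move/matrixP/(_ i j): h2; rewrite [LHS]mxE !mxE => /eqP.
    by rewrite mulf_eq0 (negPf b0) /= => /eqP.
  move/eqP: h1; rewrite b0 scale0r subr0 => /eqP h1.
  apply/matrixP => i j; move/matrixP/(_ i j): h1; rewrite !mxE => /eqP.
  by rewrite mulf_eq0 (negPf a0) /= => /eqP.
have := hm sE; rewrite /flag_size (big_setU1 _ ED) /= (big_setD1 U Us) /=.
by rewrite leq_add2r ltnS leqNgt rE hr.
Qed.

Lemma exists_low_rank_flag (s : {set {set I}}) : (forall i, v i != 0) ->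
  flag s -> separating s ->
  exists t, [/\ flag t, separating t & forall U, U \in t -> (vrank U <= r)%N].
Proof.
move=> nz fs ss; have [t [ft st] hmin] := minimal_flag fs ss.
exists t; split=> // U Ut; apply: leq_trans (minimal_flag_rank nz ft st hmin Ut) _.
apply: leq_trans (minimal_flag_card ft st hmin); apply: subset_leq_card.
by apply/subsetP => V; rewrite inE => /andP[].
Qed.

End Weights.
End Flats.

(** * Generic points of the moment curve *)

Section GenericPoints.
Variables (F : fieldType) (m : nat).

(* A row [u] stands for the polynomial [\sum_a u_a t^a]; its value is taken at
   the points [t_j = 'X^(m ^ j)], which no polynomial identity of degree less
   than [m] in each point can tell from independent indeterminates. *)
Definition genval (u : 'rV[F]_m) (j : nat) : {poly F} :=
  \sum_(a < m) u 0 a *: 'X^(a * m ^ j).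

Definition genval_mx s (A : 'M[F]_(s, m)) : 'M[{poly F}]_s :=
  \matrix_(i, j) genval (row i A) j.

Lemma genval_comb s (d : 'rV[F]_s) (A : 'M[F]_(s, m)) j :
  genval (d *m A) j = \sum_i d 0 i *: genval (row i A) j.
Proof.
rewrite /genval; under [RHS]eq_bigr do rewrite scaler_sumr.
rewrite exchange_big /=; apply: eq_bigr => a _; rewrite mxE scaler_suml.
by apply: eq_bigr => i _; rewrite mxE scalerA.
Qed.

(** The multipliers have degree below [m ^ j], so the powers of [t_j] occupy disjoint blocks of
    exponents and [a * m ^ j + b] isolates one coefficient. The inner sum is the entry [A i a], with
    [a] kept as a natural number. *)
Lemma coef_comb_genval s (A : 'M[F]_(s, m)) (c : 'I_s -> {poly F}) j a b :
  (forall i, size (c i) <= m ^ j)%N -> (a < m)%N -> (b < m ^ j)%N ->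
  (\sum_i c i * genval (row i A) j)`_(a * m ^ j + b) =
  \sum_i (c i)`_b * \sum_(a' < m | a' == a :> nat) A i a'.
Proof.
move=> hc am bM; rewrite coef_sum; apply: eq_bigr => i _.
rewrite /genval mulr_sumr coef_sum mulr_sumr [RHS]big_mkcond.
apply: eq_bigr => a' _; rewrite -scalerAr coefZ coefMXn mxE mulrC.
case: eqVneq => [->|ne].
  by rewrite ltnNge leq_addr /= addKn.
case: ltnP => h; first by rewrite mul0r.
rewrite nth_default ?mul0r //; apply: leq_trans (hc i) _.
have {ne}lt : (a' < a)%N.
  rewrite ltn_neqAle ne /=; rewrite leqNgt; apply/negP => lt.
  have : (a.+1 * m ^ j <= a' * m ^ j)%N by rewrite leq_mul2r lt orbT.
  rewrite mulSn addnC => h2; have := leq_trans h2 h.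
  by rewrite leq_add2l leqNgt bM.
rewrite leq_subRL //.
have : (a'.+1 * m ^ j <= a * m ^ j)%N by rewrite leq_mul2r lt orbT.
by rewrite mulSn addnC => h2; apply: leq_trans h2 (leq_addr _ _).
Qed.

(** For each [b], the row of coefficients of degree [b] lies in the left kernel of [A]. *)
Lemma comb_genval_eq0 s (A : 'M[F]_(s, m)) (c : 'I_s -> {poly F}) j :
  row_free A -> (forall i, size (c i) <= m ^ j)%N ->
  \sum_i c i * genval (row i A) j = 0 -> forall i, c i = 0.
Proof.
move=> fA hc h0.
have hb b : (b < m ^ j)%N -> \row_i (c i)`_b = 0.
  move=> bM; apply: (row_free_inj fA); rewrite mul0mx; apply/rowP => a.
  have := coef_comb_genval A hc (ltn_ord a) bM; rewrite h0 coef0 => h.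
  rewrite !mxE [RHS]h; apply: eq_bigr => i _; rewrite mxE; congr (_ * _).
  by rewrite (big_pred1 a).
move=> i; apply/polyP => b; rewrite coef0.
case: (ltnP b (m ^ j)) => bM; first by move/rowP/(_ i): (hb b bM); rewrite !mxE.
by rewrite nth_default //; apply: leq_trans bM.
Qed.

Lemma size_genval u j : (0 < m)%N -> (size (genval u j) <= (m.-1 * m ^ j).+1)%N.
Proof.
move=> m0; apply: leq_trans (size_sum _ _ _) _; apply/bigmax_leqP => a _.
apply: leq_trans (size_scale_leq _ _) _; rewrite size_polyXn ltnS leq_mul2r.
by rewrite -ltnS prednK // ltn_ord orbT.
Qed.

Lemma row'_genval_mx s (A : 'M[F]_(s.+1, m)) i :
  row' i (col' ord_max (genval_mx A)) = genval_mx (row' i A).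
Proof.
apply/matrixP => a b; rewrite !mxE; congr genval; last exact: lift_max.
by apply/rowP => x; rewrite !mxE.
Qed.

(** The column degrees [(m - 1) m^j], for [j < s], add up to [m^s - 1]. This is the bound that
    [comb_genval_eq0] asks of the multipliers of column [s]. *)
Lemma size_det_genval s (A : 'M[F]_(s, m)) : (0 < m)%N ->
  (size (\det (genval_mx A)) <= m ^ s)%N.
Proof.
move=> m0; elim: s => [|s IHs] in A *; first by rewrite det_mx00 size_poly1.
rewrite (expand_det_col _ ord_max).
apply: leq_trans (size_sum _ _ _) _; apply/bigmax_leqP => i _.
apply: leq_trans (size_polyMleq _ _) _.
rewrite /cofactor row'_genval_mx mxE size_Msign.
have h1 := size_genval (row i A) s m0; have h2 := IHs (row' i A).
rewrite -subn1 leq_subLR; apply: leq_trans (leq_add h1 h2) _.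
by rewrite addSn -mulSnr prednK // expnS add1n.
Qed.

Lemma row_free_row' s (A : 'M[F]_(s.+1, m)) i : row_free A -> row_free (row' i A).
Proof.
move=> fA; rewrite -kermx_eq0; apply/eqP/row_matrixP => a.
set u := row a _; rewrite row0.
have ku : u *m row' i A = 0.
  by apply/sub_kermxP; apply: row_sub.
clearbody u.
pose w := \row_j (if unlift i j is Some j' then u 0 j' else 0).
have : w = 0.
  apply: (row_free_inj fA); rewrite mul0mx -ku; apply/rowP => b; rewrite !mxE.
  rewrite (bigD1 i) //= !mxE unlift_none mul0r add0r.
  rewrite (reindex_omap (lift i) (unlift i)) /=; last first.
    by move=> j; rewrite eq_sym => /unlift_some [j' -> ->].
  apply: eq_big => [j|j _]; last by rewrite !mxE liftK.
  by rewrite liftK eqxx andbT eq_sym neq_lift.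
move=> w0; apply/rowP => b; move/rowP/(_ (lift i b)): w0.
by rewrite !mxE liftK.
Qed.

(** Expand along the last column: if the determinant vanished, so would every cofactor, but each is
    up to sign a determinant of the same kind for fewer rows. *)
Lemma det_genval_neq0 s (A : 'M[F]_(s, m)) : row_free A -> \det (genval_mx A) != 0.
Proof.
elim: s => [|s IHs] in A *; first by rewrite det_mx00 oner_eq0.
move=> fA; have m0 : (0 < m)%N.
  by move/eqP: fA => fA; apply: leq_trans (rank_leq_col A); rewrite fA.
apply/eqP; rewrite (expand_det_col _ ord_max) => h.
have : forall i, cofactor (genval_mx A) i ord_max = 0.
  apply: (comb_genval_eq0 (A := A) (j := s)) => // [i|].
    by rewrite /cofactor row'_genval_mx size_Msign size_det_genval.
  by rewrite -[RHS]h; apply: eq_bigr => i _; rewrite [in RHS]mxE mulrC.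
move/(_ ord_max)/eqP; rewrite /cofactor row'_genval_mx mulf_eq0 signr_eq0 /=.
by apply/negP; apply: IHs; apply: row_free_row'.
Qed.

(* The functional is the determinant with last row the values of [u]. *)
Lemma generic_functional s (A : 'M[F]_(s, m)) : row_free A ->
  exists c : 'I_s.+1 -> {poly F}, forall u : 'rV[F]_m,
    (\sum_j c j * genval u j == 0) = (u <= A)%MS.
Proof.
move=> fA.
pose ext u : 'M[F]_(s.+1, m) :=
  \matrix_i (if unlift ord_max i is Some i' then row i' A else u).
have extl u i : row (lift ord_max i) (ext u) = row i A by rewrite rowK liftK.
have extm u : row ord_max (ext u) = u by rewrite rowK unlift_none.
(* Cofactors along the last row do not depend on that row, so [ext 0] serves for every [u]. *)
pose c j := cofactor (genval_mx (ext 0)) ord_max j.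
have cE u : \sum_j c j * genval u j = \det (genval_mx (ext u)).
  rewrite (expand_det_row _ ord_max); apply: eq_bigr => j _.
  rewrite [genval_mx _ _ _]mxE extm mulrC; congr (_ * (_ * \det _)).
  by apply/matrixP => a b; rewrite !(mxE, extl).
exists c => u; apply/idP/idP; last first.
  move=> /submxP [d ->].
  under eq_bigr do rewrite genval_comb mulr_sumr.
  rewrite exchange_big /= big1 // => i _.
  under eq_bigr do rewrite -scalerAr.
  rewrite -scaler_sumr cE (determinant_alternate (neq_lift ord_max i)) ?scaler0 //.
  by move=> j; rewrite !mxE extl extm.
apply: contraLR => uA; rewrite cE; apply: det_genval_neq0.
have sAB : (A <= ext u)%MS by apply/row_subP => i; rewrite -(extl u); apply: row_sub.
have suB : (u <= ext u)%MS by rewrite -[X in (X <= _)%MS](extm u) row_sub.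
rewrite /row_free eqn_leq rank_leq_row /=.
have := mxrank_leqif_sup sAB; move/eqP: fA => ->; move=> /leqifP.
by case: ifP => // /(submx_trans suB); rewrite (negPf uA).
Qed.

End GenericPoints.

(** * The flag of an independent family *)

Section MonomialRing.
Variables (F K : fieldType) (r : nat) (iota : {rmorphism {mpoly F[r]} -> K}).
Hypothesis iota_inj : injective iota.

(* Elements all of whose monomials have value at least (for [b = true], greater
   than) [0] for the valuation sending each monomial to its exponent. *)
Definition monomial_ge (b : bool) (y : K) := exists (P : {mpoly F[r]}) a,
  (forall m, m \in msupp P -> if b then (a < m)%O else (a <= m)%O) /\
  y = iota P / iota 'X_[a].

Lemma iota_monomial_neq0 a : iota 'X_[a] != 0.
Proof.
rewrite -(rmorph0 iota) (inj_eq iota_inj) -msupp_eq0 msuppX.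
by [].
Qed.

Lemma monomial_geD b x y : monomial_ge b x -> monomial_ge b y -> monomial_ge b (x + y).
Proof.
move=> [P [a [hP ->]]] [Q [c [hQ ->]]].
exists (P * 'X_[c] + Q * 'X_[a]), (a + c)%MM; split.
  move=> m /msuppD_le; rewrite mem_cat => /orP [] /msuppM_le /allpairsP [[m1 m2] /=].
    case=> /hP h; rewrite msuppX inE => /eqP -> ->.
    by case: b {hP hQ} h; rewrite ?ltmc_add2l ?lemc_add2l.
  case=> /hQ h; rewrite msuppX inE => /eqP -> ->; rewrite [(m1 + a)%MM]addmC.
  by case: b {hP hQ} h; rewrite ?ltmc_add2r ?lemc_add2r.
rewrite mpolyXD rmorphD !rmorphM /= addf_div ?iota_monomial_neq0 //.
Qed.

Lemma monomial_geM b c x y :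
  monomial_ge b x -> monomial_ge c y -> monomial_ge (b || c) (x * y).
Proof.
move=> [P [a [hP ->]]] [Q [a' [hQ ->]]]; exists (P * Q), (a + a')%MM; split.
  move=> m /msuppM_le /allpairsP [[m1 m2] /= [/hP h1 /hQ h2 ->]].
  move: h1 h2; case: b {hP}; case: c {hQ} => /=.
  - exact: ltm_add.
  - exact: ltmc_le_add.
  - exact: lemc_lt_add.
  - exact: lem_add.
by rewrite mpolyXD !rmorphM /= mulf_div.
Qed.

Lemma monomial_ge_scalar c : monomial_ge false (iota c%:MP).
Proof.
exists c%:MP, 0%MM; split; last by rewrite mpolyX0 rmorph1 divr1.
by move=> m; rewrite msuppC; case: ifP => // _; rewrite inE => /eqP ->.
Qed.

Lemma monomial_gt_ratio a c : (a < c)%O -> monomial_ge true (iota 'X_[c] / iota 'X_[a]).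
Proof. by move=> ac; exists 'X_[c], a; split=> // m; rewrite msuppX inE => /eqP ->. Qed.

Lemma ring_ideal_monomial : ring_ideal (monomial_ge false) (monomial_ge true).
Proof.
split.
- by rewrite -(rmorph1 iota) -mpolyC1; apply: monomial_ge_scalar.
- move=> x hx; rewrite -mulN1r; apply: (@monomial_geM false false) hx.
  by rewrite -(rmorphN1 iota) -mpolyC1 -mpolyCN; apply: monomial_ge_scalar.
- exact: monomial_geD.
- exact: (@monomial_geM false false).
- by exists 0, 0%MM; split; [move=> m; rewrite msupp0|rewrite rmorph0 mul0r].
- exact: monomial_geD.
- exact: (@monomial_geM false true).
- by move=> x [P [a [hP ->]]]; exists P, a; split=> // m /hP /ltW.
(* If [1] were in the ideal, injectivity of [iota] would give [P = 'X_[a]], whose exponent is not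
   above [a]. *)
- move=> [P [a [hP /esym/eqP]]].
  rewrite -[X in _ == X](divff (iota_monomial_neq0 a)).
  rewrite (inj_eq (divIf (iota_monomial_neq0 a))) (inj_eq iota_inj) => /eqP PE.
  by have := hP a; rewrite PE msuppX inE ltxx eqxx => /(_ isT).
Qed.

End MonomialRing.

(** * Classes of forms of equal value *)

Section ValueClasses.
Variables (K : fieldType) (B J : K -> Prop) (I : finType) (l : I -> K).
Hypotheses (hB : ring_ideal B J) (l0 : forall i, l i != 0).
Hypothesis total : forall i j, B (l i / l j) \/ B (l j / l i).
Variable S : I -> {set I}.
Hypothesis SP : forall c i, i \in S c <-> B (l i / l c).

Lemma value_class_refl c : c \in S c.
Proof. by apply/SP; rewrite divff //; apply: ri1 hB. Qed.

Lemma value_class_sub c i : i \in S c -> S i \subset S c.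
Proof.
move=> /SP ic; apply/subsetP => j /SP ji; apply/SP.
by have := riM hB ji ic; rewrite mulrA divfK.
Qed.

Lemma value_class_chain i j : (S i \subset S j) || (S j \subset S i).
Proof. by case: (total i j) => /SP /value_class_sub ->; rewrite ?orbT. Qed.

Lemma ring_ideal_exprz x (z : int) : B x -> B x^-1 -> B (x ^ z).
Proof.
move=> hx hx'; have hn y k : B y -> B (y ^+ k).
  move=> hy; elim: k => [|k IHk]; first by rewrite expr0; apply: ri1 hB.
  by rewrite exprS; apply: (riM hB).
by case: z => k; rewrite ?NegzE ?exprz_inv -?exprz_inv; [exact: hn|apply: hn].
Qed.

(** [S c] collects the forms of value at least that of [l c]. Zero weight on all these sets forces
    zero weight on each class of equal value, and within a class the ratios are units of [B]. *)
Lemma value_class_prod (w : I -> int) : (forall c, \sum_(i in S c) w i = 0) ->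
  B (\prod_i l i ^ w i).
Proof.
move=> hw; rewrite (partition_big S predT) //=.
have Bprod (T : finType) (P : pred T) (f : T -> K) :
    (forall i, P i -> B (f i)) -> B (\prod_(i | P i) f i).
  by move=> hf; apply: (@big_ind _ B) => //; [exact: ri1 hB|exact: (riM hB)].
apply: (Bprod _ _ _) => A _.
case: (pickP (fun c => S c == A)) => [c /eqP cA|h0]; last first.
  by rewrite big_pred0 //; apply: ri1 hB.
have sum0 : \sum_(i | S i == A) w i = 0.
  have := hw c; rewrite (bigID (fun i => S i == A)) /=.
  have -> : \sum_(i in S c | S i == A) w i = \sum_(i | S i == A) w i.
    apply: eq_bigl => i; case: eqVneq => [iA|]; rewrite ?andbF // andbT.
    by rewrite cA -iA value_class_refl.
  suff -> : \sum_(i in S c | S i != A) w i = 0 by rewrite addr0.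
  case: (pickP (fun i => (i \in S c) && (S i != A))) => [i0 hi0|h0]; last first.
    by rewrite big_pred0.
  pose P i := (i \in S c) && (S i != A).
  (* The part of [S c] of strictly larger value is [S i], for a member [i] of it with [S i]
     largest. *)
  case: (@arg_maxnP _ i0 P (fun i => #|S i|) hi0) => i /andP[iS iA] hmax.
  rewrite -[RHS](hw i); apply: eq_bigl => j; apply/andP/idP => [hj|ji].
    case/orP: (value_class_chain j i) => [/subsetP|] h.
      exact/h/value_class_refl.
    have /eqP -> : S i == S j by rewrite eqEcard h; apply: hmax; apply/andP.
    exact: value_class_refl.
  have jc := subsetP (value_class_sub iS) _ ji; split=> //.
  apply: contra iA => /eqP jA; rewrite eqEsubset -{1}cA value_class_sub //=.
  by rewrite -jA value_class_sub.
(* Since the weights of the class sum to zero, every form may be divided by [l c] at no cost. *)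
have -> : \prod_(i | S i == A) l i ^ w i = \prod_(i | S i == A) (l i / l c) ^ w i.
  have e1 : 1 = \prod_(i | S i == A) (l c)^-1 ^ w i.
    transitivity ((l c)^-1 ^ (\sum_(i | S i == A) w i)); first by rewrite sum0 expr0z.
    apply: (big_morph (fun z => (l c)^-1 ^ z)) => [a b|]; last by rewrite expr0z.
    by rewrite expfzDr // invr_eq0.
  rewrite -[LHS]mulr1 [X in _ * X]e1.
  by rewrite -big_split /=; apply: eq_bigr => i _; rewrite expfzMl.
apply: Bprod => i /eqP iA; apply: ring_ideal_exprz.
  by apply/SP; rewrite cA -iA value_class_refl.
by rewrite invf_div; apply/SP; rewrite iA -cA value_class_refl.
Qed.

End ValueClasses.

Lemma vspan_ind (F : fieldType) (m : nat) (I : finType) (v : I -> 'rV[F]_m)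
    (S : {set I}) (Q : 'rV[F]_m -> Prop) :
  Q 0 -> (forall u u', Q u -> Q u' -> Q (u + u')) ->
  (forall c u, Q u -> Q (c *: u)) -> (forall i, i \in S -> Q (v i)) ->
  forall u, (u <= vspan v S)%MS -> Q u.
Proof.
move=> Q0 QD QZ Qv u /sub_sumsmxP [x ->]; apply: (@big_ind _ Q) => // i iS.
have /sub_rVP [c ->] : (x i *m <<v i>> <= v i)%MS.
  by apply: submx_trans (submxMl _ _) _; rewrite genmxE.
exact/QZ/Qv.
Qed.

Section AffineForms.
Variables (F : fieldType) (N : nat).

Definition affform (u : 'rV[F]_N.+1) : {mpoly F[N]} :=
  (u 0 ord0)%:MP + \sum_(b < N) u 0 (lift ord0 b) *: 'X_b.

Definition affvec (p : {mpoly F[N]}) : 'rV[F]_N.+1 :=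
  \row_a (if unlift ord0 a is Some b then p@_U_(b) else p@_0%MM).

Lemma affformD u u' : affform (u + u') = affform u + affform u'.
Proof.
rewrite /affform mxE mpolyCD addrACA -big_split; congr (_ + _).
by apply: eq_bigr => b _; rewrite mxE scalerDl.
Qed.

Lemma affformZ c u : affform (c *: u) = c *: affform u.
Proof.
rewrite /affform mxE scalerDr scaler_sumr -!mul_mpolyC mpolyCM; congr (_ + _).
by apply: eq_bigr => b _; rewrite mxE scalerA.
Qed.

Lemma affform0 : affform 0 = 0.
Proof. by rewrite -[0](scale0r 0) affformZ scale0r. Qed.

Lemma affvecK p : deg_le p 1 -> affform (affvec p) = p.
Proof.
rewrite /deg_le => hp; apply/mpolyP => m; rewrite /affform mxE unlift_none.
rewrite mcoeffD mcoeffC raddf_sum /=.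
under eq_bigr do rewrite mxE liftK mcoeffZ mcoeffX.
case: (ltnP 1 (mdeg m)) => dm.
  rewrite (_ : m == 0%MM = false); last first.
    by apply/negbTE; apply: contraTneq dm => ->; rewrite mdeg0.
  rewrite mulr0 add0r big1; last first.
    move=> b _; case: eqVneq => [e|]; last by rewrite mulr0.
    by move: dm; rewrite -e mdeg1.
  by apply/esym/memN_msupp_eq0/msize_mdeg_ge; apply: leq_trans hp dm.
case: (eqVneq m 0%MM) => [->|m0].
  rewrite mulr1 big1 ?addr0 // => b _.
  by rewrite mnm1_eq0 mulr0.
rewrite mulr0 add0r.
have /mdeg1P [b /eqP ->] : mdeg m == 1%N.
  by rewrite eqn_leq dm lt0n mdeg_eq0.
rewrite (bigD1 b) //= eqxx mulr1 big1 ?addr0 // => c cb.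
rewrite (_ : (U_(c) == U_(b))%MM = false) ?mulr0 //; apply/negbTE.
by apply: contra cb => /eqP/mnmP/(_ c); rewrite !mnm1E eqxx eq_sym; case: eqP.
Qed.

End AffineForms.

Definition form_vec (F : fieldType) (N r d : nat)
    (L : 'I_r -> 'I_d -> {mpoly F[N]}) (o : option ('I_r * 'I_d)) :=
  affvec (if o is Some ij then L ij.1 ij.2 else 1).

(* [None] stands for the hyperplane at infinity: the form [1], of multiplicity
   [- d] in each product of [d] affine forms. *)
Definition form_weight (r d : nat) (o : option ('I_r * 'I_d)) : 'cV[int]_r :=
  if o is Some ij then delta_mx ij.1 0 else const_mx (- d%:Z).

Section FlagOfIndependent.
Variables (F : fieldType) (N r d : nat) (L : 'I_r -> 'I_d -> {mpoly F[N]}).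
Let T i := \prod_(j < d) L i j.
Hypotheses (degL : forall i j, deg_le (L i j) 1) (indT : alg_indep T).

Lemma alg_indep_factor_neq0 i j : L i j != 0.
Proof.
have : 'X_i != 0 :> {mpoly F[r]} by rewrite -msupp_eq0 msuppX.
move=> /indT; rewrite comp_mpolyXU -tnth_nth tnth_mktuple.
by move=> /prodf_neq0 /(_ j isT).
Qed.

Lemma affform_form_vec o :
  affform (form_vec L o) = if o is Some ij then L ij.1 ij.2 else 1.
Proof.
by rewrite affvecK //; case: o => [[i j]|] //; rewrite /deg_le msize1.
Qed.

Lemma form_vec_neq0 o : form_vec L o != 0.
Proof.
have : affform (form_vec L o) != 0.
  rewrite affform_form_vec; case: o => [[i j]|]; last exact: oner_neq0.
  exact: alg_indep_factor_neq0.
by apply: contraNneq => ->; rewrite affform0.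
Qed.

Let K : fieldType := {fraction {mpoly F[N]}}.
Let iota : {rmorphism {mpoly F[r]} -> K} :=
  @FracField.tofrac _ \o comp_mpoly [tuple T i | i < r].
Let l o : K := FracField.tofrac (affform (form_vec L o)).

Let l_neq0 o : l o != 0.
Proof.
rewrite tofrac_eq0 affform_form_vec; case: o => [[i j]|]; last exact: oner_neq0.
exact: alg_indep_factor_neq0.
Qed.

Let iota_inj : injective iota.
Proof.
apply: raddf_inj => p /eqP; rewrite tofrac_eq0 => p0; apply/eqP.
by apply: contraTT p0; apply: indT.
Qed.

Let iotaX a : iota 'X_[a] = \prod_i (\prod_j l (Some (i, j))) ^+ a i.
Proof.
rewrite /= comp_mpolyX rmorph_prod; apply: eq_bigr => i _.
rewrite rmorphXn /= tnth_mktuple rmorph_prod; congr (_ ^+ _).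
by apply: eq_bigr => j _; rewrite /l affform_form_vec.
Qed.

Let pos (z : int) : nat := if z is Posz k then k else 0%N.
Let neg (z : int) : nat := if z is Negz k then k.+1 else 0%N.

(** Links weights with monomials: this product of forms is the Laurent monomial in the [T i] of
    exponent [n], the form at infinity contributing [1]. *)
Let prod_weight (n : 'rV[int]_r) :
  \prod_o l o ^ ((n *m form_weight o) 0 0) =
  iota 'X_[[multinom pos (n 0%R i) | i < r]] / iota 'X_[[multinom neg (n 0%R i) | i < r]].
Proof.
rewrite !iotaX (bigD1 None) //= {1}/l affform_form_vec rmorph1 exp1rz mul1r.
rewrite (reindex_omap Some id) /=; last by case.
under eq_bigl do rewrite eqxx.
rewrite -(pair_bigA _ (fun i j => l (Some (i, j)) ^ ((n *m delta_mx i 0) 0 0))) /=.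
rewrite -prodf_div; apply: eq_bigr => i _.
under eq_bigr => j _.
  rewrite (_ : (n *m delta_mx i 0) 0 0 = n 0 i); last by rewrite -colE mxE.
  over.
rewrite !mnmE; case: (n 0 i) => k /=.
  by rewrite expr0 divr1 -prodrXl.
rewrite expr0 mul1r -prodrXl -prodfV; exact: eq_bigr.
Qed.

(* The classes of the forms for a valuation of [F(X)] that sends the monomials
   in the [T i] to pairwise distinct values. *)
Lemma exists_separating_flag :
  exists s, flag (form_vec L) s /\ separating (@form_weight r d) s.
Proof.
pose rs := [seq l p.1 / l p.2 | p : option ('I_r * 'I_d) * option ('I_r * 'I_d)].
have rs0 : {in rs, forall x, x != 0}.
  by move=> _ /mapP [[i j] _ ->]; rewrite mulf_neq0 ?invr_eq0.
have [B [J [hB sB sJ tB]]] := chevalley_seq (ring_ideal_monomial iota_inj) rs0.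
have total i j : B (l i / l j) \/ B (l j / l i).
  have /tB : l i / l j \in rs by apply/mapP; exists (i, j); rewrite ?mem_enum.
  by rewrite invf_div.
have scalB c : B (FracField.tofrac c%:MP).
  by have /sB := monomial_ge_scalar iota c; rewrite /= comp_mpolyC.
have exS c : exists S : {set option ('I_r * 'I_d)}, forall i, i \in S <-> B (l i / l c).
  have ex i : exists b : bool, b <-> B (l i / l c).
    by case: (classic (B (l i / l c))) => h; [exists true|exists false].
  have [b hb] := fin_all_exists ex; exists [set i | b i] => i.
  by rewrite inE.
have [S SP] := fin_all_exists exS.
exists [set S c | c in predT]; split; first split.
- move=> _ /imsetP [c _ ->] i hi; apply/SP; rewrite /l.
  (* Flatness: the forms of value at least that of [l c] are closed under linear combinations,
     because [B] contains the scalars. *)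
  pose Q u := B (FracField.tofrac (affform u) / l c).
  apply: (@vspan_ind _ _ _ _ _ Q) hi.
  + by rewrite /Q affform0 rmorph0 mul0r; apply: ri0 hB.
  + by move=> u u' hu hu'; rewrite /Q affformD rmorphD mulrDl; apply: (riD hB).
  + move=> a u hu; rewrite /Q affformZ -mul_mpolyC rmorphM /= -mulrA.
    exact: (riM hB).
  + by move=> j /SP.
- move=> _ _ /imsetP [c _ ->] /imsetP [c' _ ->].
  exact: (value_class_chain hB l_neq0 total SP).
move=> n hn.
have hw (n' : 'rV[int]_r) : (forall c, n' *m weight (@form_weight r d) (S c) = 0) ->
    B (\prod_o l o ^ ((n' *m form_weight o) 0 0)).
  move=> hn'; apply: (value_class_prod hB l_neq0 total SP) => c.
  have /matrixP/(_ 0 0) := hn' c; rewrite mulmx_sumr summxE => ->.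
  by rewrite mxE.
have {}hn c : n *m weight (@form_weight r d) (S c) = 0 by apply: hn; apply: imset_f.
(* Both [n] and [- n] kill all weights, so the Laurent monomial of exponent [n] is a unit of [B]. *)
have h1 := hw _ hn.
have h2 : B (\prod_o l o ^ (((- n) *m form_weight o) 0 0)).
  by apply: hw => c; rewrite mulNmx hn oppr0.
have {}h2 : B (\prod_o l o ^ ((n *m form_weight o) 0 0))^-1.
  rewrite -prodfV; have -> // : \prod_o (l o ^ ((n *m form_weight o) 0 0))^-1
    = \prod_o l o ^ (((- n) *m form_weight o) 0 0).
  by apply: eq_bigr => o _; rewrite mulNmx [in RHS]mxE invr_expz.
move: h1 h2; rewrite prod_weight invf_div.
set a := [multinom _ | i < r]; set b := [multinom _ | i < r] => h1 h2.
have noJ x : x != 0 -> B x -> ~ J x^-1.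
  by move=> x0 hx /(riJM hB hx); rewrite divff //; apply: riJ1 hB.
have X0 := iota_monomial_neq0 iota_inj.
(* Distinct exponents would put this monomial or its inverse in [J], which contains no unit. Hence
   the positive and negative parts of [n] agree, and [n] is zero. *)
case: (ltgtP a b) => [ab|ba|eqab].
- have /sJ := monomial_gt_ratio iota ab; rewrite -invf_div => /noJ [] //.
  by rewrite mulf_neq0 ?invr_eq0.
- have /sJ := monomial_gt_ratio iota ba; rewrite -invf_div => /noJ [] //.
  by rewrite mulf_neq0 ?invr_eq0.
apply/rowP => i; move/mnmP/(_ i): eqab; rewrite !mnmE mxE /pos /neg.
by case: (n 0 i) => // k ->.
Qed.

End FlagOfIndependent.

(** * Specialization to the generator *)

(** The functional of [generic_functional] uses one point more than the rank; its coefficients are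
    padded with zeros up to [k + 1] points. *)
Lemma vspan_functional (F : fieldType) (m : nat) (I : finType) (v : I -> 'rV[F]_m)
    (k : nat) (U : {set I}) : (vrank v U <= k)%N ->
  exists c : 'I_k.+1 -> {poly F}, forall u : 'rV[F]_m,
    (\sum_j c j * genval u j == 0) = (u <= vspan v U)%MS.
Proof.
move=> hU; have [c hc] := generic_functional (row_base_free (vspan v U)).
exists (fun j => if (j < (vrank v U).+1)%N then c (inord j) else 0) => u.
have <- : (u <= row_base (vspan v U))%MS = (u <= vspan v U)%MS by rewrite eq_row_base.
rewrite -hc.
pose f j := c (inord j) * genval u j.
under [in RHS]eq_bigr => j _ do rewrite -{1}(inord_val j).
rewrite (big_ord_widen k.+1 f) ?ltnS // [in RHS]big_mkcond /=; congr (_ == 0).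
by apply: eq_bigr => j _; rewrite /f; case: ifP => // _; rewrite mul0r.
Qed.

(** The order on indeterminates reverses that on indices, so a linear form is led by its first
    indeterminate. *)
Lemma leq_mnm1 n (i j : 'I_n) : (i <= j)%N -> (U_(j)%MM <= U_(i)%MM)%O.
Proof.
rewrite leq_eqVlt => /orP [/eqP/val_inj -> //|ij]; apply: ltW.
apply/ltmcP; first by rewrite !mdeg1.
exists i; last by rewrite !mnm1E eqxx -val_eqE /= gtn_eqF.
by move=> a ai; rewrite !mnm1E -!val_eqE /= !gtn_eqF // (ltn_trans ai).
Qed.

Lemma mlead_linear (R : idomainType) n (a : 'I_n -> R) (l : 'I_n) :
  (forall i : 'I_n, (i < l)%N -> a i = 0) -> a l != 0 ->
  \sum_i a i *: 'X_i != 0 :> {mpoly R[n]} /\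
  mlead (\sum_i a i *: 'X_i : {mpoly R[n]}) = U_(l)%MM.
Proof.
move=> a0 al; set p := \sum_i _.
have pc i : p@_U_(i) = a i.
  rewrite /p raddf_sum /= (bigD1 i) //= mcoeffZ mcoeffXU eqxx mulr1 big1 ?addr0 //.
  by move=> j ji; rewrite mcoeffZ mcoeffXU (negPf ji) mulr0.
have pl : U_(l)%MM \in msupp p by rewrite mcoeff_msupp pc.
have p0 : p != 0 by rewrite -msupp_eq0; apply: contraTneq pl => ->.
split=> //; apply/eqP; rewrite eq_le msupp_le_mlead // andbT.
have := mlead_supp p0 => /msupp_sum_le /flattenP [_ /mapP [i _ ->]].
move=> /msuppZ_le; rewrite msuppX inE => /eqP e.
have : p@_(mlead p) != 0 by rewrite mleadc_eq0.
rewrite e pc => ai; apply: leq_mnm1; rewrite leqNgt.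
by apply: contra ai => /a0 ->.
Qed.

(** The largest leading monomial comes from a single term and cannot cancel. *)
Lemma sum_mlead_inj_neq0 (R : idomainType) n (T : eqType) (s : seq T)
    (f : T -> {mpoly R[n]}) : s != [::] -> uniq s ->
  (forall x, x \in s -> f x != 0) ->
  {in s &, injective (fun x => mlead (f x))} -> \sum_(x <- s) f x != 0.
Proof.
move=> s0 us nz inj.
have [x xs hmax] : exists2 x, x \in s & forall y, y \in s -> (mlead (f y) <= mlead (f x))%O.
  elim: s {us nz inj} s0 => // x s IHs _; case: (eqVneq s [::]) => [->|/IHs [y ys hy]].
    by exists x => [|y]; rewrite inE // => /eqP ->.
  case: (leP (mlead (f x)) (mlead (f y))) => h.
    by exists y; rewrite ?inE ?ys ?orbT // => z; rewrite inE => /orP [/eqP ->|/hy].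
  exists x; rewrite ?inE ?eqxx // => z; rewrite inE => /orP [/eqP ->//|/hy h2].
  exact: le_trans h2 (ltW h).
suff : (\sum_(x <- s) f x)@_(mlead (f x)) != 0 by apply: contraNneq => ->; rewrite mcoeff0.
rewrite raddf_sum /= (bigD1_seq x) //= [X in _ + X]big_seq_cond big1 ?addr0 ?mleadc_eq0 ?nz //.
move=> y /andP[ys yx]; apply: mcoeff_gt_mlead; rewrite lt_neqAle hmax // andbT.
by apply: contra yx => /eqP /inj ->.
Qed.

(** * Leading monomials along a flag *)

Section LeadingMonomials.
Variables (F : fieldType) (m : nat) (I : finType) (v : I -> 'rV[F]_m).
Variables (r k : nat) (w : I -> 'cV[int]_r) (s : {set {set I}}).
Hypotheses (v0 : forall i, v i != 0) (fs : flag v s) (ss : separating w s).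
Hypothesis rk : forall U, U \in s -> (vrank v U <= k)%N.

Let Q := #|I|.
(** The largest member with at most [Q - i] elements, or the empty set. This lists the flag as a
    decreasing sequence, with [U] at position [Q - #|U|] and the empty set at [Q]. *)
Let V (i : nat) : {set I} := \bigcup_(U in s | (#|U| <= Q - i)%N) U.

Let V_sub i j : (i <= j)%N -> V j \subset V i.
Proof.
move=> ij; apply/bigcupsP => U /andP[Us hU]; apply: bigcup_sup.
by rewrite Us (leq_trans hU) // leq_sub2l.
Qed.

Let V_cases i : V i = set0 \/ V i \in s.
Proof.
case: (pickP (fun U => (U \in s) && (#|U| <= Q - i)%N)) => [U0 h0|h0]; last first.
  by left; rewrite /V big_pred0.
right; case: (@arg_maxnP _ U0 (fun U => (U \in s) && (#|U| <= Q - i)%N) (fun U => #|U|) h0).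
move=> U /andP[Us Ui] hmax; suff -> : V i = U by [].
apply/eqP; rewrite eqEsubset bigcup_sup ?Us // andbT; apply/bigcupsP => U' hU'.
have /andP[U's _] := hU'; case/orP: (fs.2 _ _ U's Us) => // h.
by have /eqP -> : U == U' by rewrite eqEcard h; apply: hmax.
Qed.

Let V_flat i : flat v (V i).
Proof. by case: (V_cases i) => [->|/fs.1 //]; apply: flat0. Qed.

Let V_last : V Q = set0.
Proof.
apply/eqP; rewrite -subset0; apply/bigcupsP => U; rewrite subnn leqn0 cards_eq0.
by move=> /andP[_ /eqP ->].
Qed.

Let V_mem U : U \in s -> V (Q - #|U|) = U.
Proof.
move=> Us; apply/eqP; rewrite eqEsubset.
rewrite /V subKn ?max_card // bigcup_sup ?Us //= andbT.
apply/bigcupsP => U' /andP[U's h]; case/orP: (fs.2 _ _ U's Us) => // h'.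
by have /eqP -> : U == U' by rewrite eqEcard h'.
Qed.

(* The flats [V i] decrease, so the leading indeterminate of a form at the point
   [y] is that of the largest flat not containing it. *)
Lemma generic_flag_point : exists q (y : 'I_k.+1 -> {mpoly {poly F}[q]}),
  let phi i := \sum_j y j * (genval (v i) j)%:MP in
  (forall i, phi i != 0) /\
  forall (e e' : I -> nat) (n : 'rV[int]_r),
    (forall i, (n *m w i) 0 0 = (e i)%:Z - (e' i)%:Z) ->
    mlead (\prod_i phi i ^+ e i) = mlead (\prod_i phi i ^+ e' i) -> n = 0.
Proof.
have exc (i : 'I_Q.+1) : exists c : 'I_k.+1 -> {poly F}, forall u,
    (\sum_j c j * genval u j == 0) = (u <= vspan v (V i))%MS.
  apply: vspan_functional; case: (V_cases i) => [->|/rk //].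
  by rewrite vrank0.
have [c hc] := fin_all_exists exc.
(* The coefficient of ['X_i] in [phi o] is then a functional of [v o] that vanishes exactly when [o]
   lies in [V i]. *)
pose y j : {mpoly {poly F}[Q.+1]} := \sum_i c i j *: 'X_i.
have exl o : exists l : 'I_Q.+1, forall i : 'I_Q.+1, (o \in V i) = (i < l)%N.
  have h0 : o \notin V (@ord_max Q) by rewrite V_last inE.
  case: (@arg_minnP _ ord_max (fun i : 'I_Q.+1 => o \notin V i) val h0) => l hl hmin.
  exists l => i; apply/idP/idP => [oi|].
    rewrite ltnNge; apply: contra hl => li; apply: subsetP oi; exact: V_sub.
  by apply: contraTT => /hmin; rewrite -leqNgt.
have [l hl] := fin_all_exists exl.
exists Q.+1, y => phi.
have phiE o : phi o = \sum_i (\sum_j c i j * genval (v o) j) *: 'X_i.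
  rewrite /phi; under eq_bigr do rewrite mulr_suml.
  rewrite exchange_big /=; apply: eq_bigr => i _; rewrite scaler_suml.
  by apply: eq_bigr => j _; rewrite mulrC mul_mpolyC scalerA mulrC.
have memV o (i : 'I_Q.+1) : (v o <= vspan v (V i))%MS = (i < l o)%N.
  by rewrite -hl; apply/idP/idP; [exact: V_flat|exact: mem_vspan].
have lead o : phi o != 0 /\ mlead (phi o) = U_(l o)%MM.
  rewrite phiE; apply: mlead_linear => [i il|].
    by apply/eqP; rewrite hc memV.
  by rewrite hc memV ltnn.
split=> [o|e e' n hn]; first by case: (lead o).
have leadE (f : I -> nat) : mlead (\prod_i phi i ^+ f i) = (\sum_i U_(l i) *+ f i)%MM.
  rewrite mlead_prod => [|i _ _]; last by rewrite expf_neq0 // (lead i).1.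
  by apply: eq_bigr => i _; rewrite mleadX ?(lead i).1 // (lead i).2.
rewrite !leadE => /mnmP hee; apply: ss => U /V_mem <-.
have hq : (Q - #|U| < Q.+1)%N by rewrite ltnS leq_subr.
rewrite -[(Q - #|U|)%N]/(nat_of_ord (Ordinal hq)); move: (Ordinal hq) => {hq} q.
(* Comparing the exponents of ['X_i] gives zero weight on the forms led by ['X_i]; [V q] is the
   union of these classes for [i > q]. *)
have sum0 (i : 'I_Q.+1) : \sum_(o | l o == i) ((e o)%:Z - (e' o)%:Z) = 0.
  have := hee i; rewrite !mnm_sumE => h.
  have red (f : I -> nat) : (\sum_(o | l o == i) f o = \sum_o (U_(l o) *+ f o)%MM i)%N.
    rewrite big_mkcond; apply: eq_bigr => o _; rewrite mulmnE mnm1E.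
    by case: eqP; rewrite ?mul1n ?mul0n.
  by rewrite sumrB -!(big_morph Posz PoszD (erefl _)) !red h subrr.
apply/matrixP => a b; rewrite !ord1 mulmx_sumr summxE [RHS]mxE.
under eq_bigr do rewrite hn.
rewrite (partition_big l predT) //= big1 // => i _.
case: (ltnP q i) => qi.
  rewrite -[RHS](sum0 i); apply: eq_bigl => o; rewrite hl.
  by case: eqP => [->|]; rewrite ?qi ?andbF.
rewrite big_pred0 // => o; rewrite hl; case: eqP => [->|]; rewrite ?andbF //.
by rewrite ltnNge qi.
Qed.

End LeadingMonomials.

Definition power_sum_gen (F : fieldType) (N k : nat) : N.-tuple {mpoly F[k.+1 + k.+1]} :=
  [tuple \sum_(j < k.+1) 'X_(lshift _ j) * 'X_(rshift _ j) ^+ a | a < N].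

Section Specialization.
Variables (F : fieldType) (N r d k : nat) (L : 'I_r -> 'I_d -> {mpoly F[N]}).
Let T i := \prod_(j < d) L i j.
Hypotheses (degL : forall i j, deg_le (L i j) 1) (indT : alg_indep T).
Hypothesis rk : (r <= k)%N.

(** The seed is specialized so that each form [o] takes the value [phi o / phi None]. Once
    denominators are cleared, the terms of a nonzero [H] have distinct leading monomials. *)
Lemma power_sum_gen_indep : alg_indep (fun i => T i \mPo power_sum_gen F N k).
Proof.
have v0 := form_vec_neq0 degL indT; have [s0 [fs0 ss0]] := exists_separating_flag degL indT.
have [s [fs ss rs]] := exists_low_rank_flag v0 fs0 ss0.
have {}rs U : U \in s -> (vrank (form_vec L) U <= k)%N by move/rs/leq_trans; apply.
have [q [y [phi0 lead_inj]]] := generic_flag_point v0 fs ss rs.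
pose phi o := \sum_j y j * (genval (form_vec L o) j)%:MP.
rewrite -/phi in phi0 lead_inj.
pose P := {mpoly {poly F}[q]}; pose K : fieldType := {fraction P}.
pose fr : {rmorphism P -> K} := @FracField.tofrac P.
have fr_inj : injective fr by move=> a b /eqP; rewrite tofrac_eq => /eqP.
pose cst : {rmorphism F -> K} := fr \o (@mpolyC q {poly F} \o polyC).
pose tau (j : nat) : P := ('X^(N.+1 ^ j))%:MP.
pose x0 := phi None.
(* Output [a] of the generator pairs with coordinate [a + 1] of [affvec], whence the extra factor
   [tau j]; dividing by [x0] sends the form at infinity to [1]. *)
pose h (a : 'I_(k.+1 + k.+1)) : K := match split a with
  | inl j => fr (y j * tau j) / fr x0 | inr j => fr (tau j) end.
pose ev : {rmorphism {mpoly F[k.+1 + k.+1]} -> K} := mmap cst h.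
have fx0 : fr x0 != 0 by rewrite -(rmorph0 fr) (inj_eq fr_inj) phi0.
have x0E : x0 = \sum_j y j.
  rewrite /x0 /phi; apply: eq_bigr => j _.
  suff -> : genval (form_vec L None) j = 1 by rewrite mpolyC1 mulr1.
  rewrite /genval big_ord_recl mul0n expr0 mxE unlift_none mcoeff1 eqxx alg_polyC.
  rewrite big1 ?addr0 // => b _; rewrite mxE liftK mcoeff1 mnm1_eq0.
  by rewrite scale0r.
have evG a : ev (tnth (power_sum_gen F N k) a) = fr (\sum_j y j * tau j ^+ a.+1) / fr x0.
  rewrite tnth_mktuple rmorph_sum rmorph_sum mulr_suml; apply: eq_bigr => j _.
  rewrite rmorphM rmorphXn /= /ev /= !mmapX !mmap1U /h.
  rewrite (unsplitK (inl j)) (unsplitK (inr j)) exprS.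
  by rewrite mulrAC -rmorphXn -rmorphM mulrA.
have evL o : ev (affform (form_vec L o) \mPo power_sum_gen F N k) = fr (phi o) / fr x0.
  set u := form_vec L o.
  rewrite /affform comp_mpolyD comp_mpolyC raddf_sum /= rmorphD rmorph_sum.
  have -> : ev (u 0 ord0)%:MP = fr ((u 0 ord0)%:P%:MP * x0) / fr x0.
    by rewrite rmorphM mulfK // /ev /= mmapC.
  have -> : \sum_(b < N) ev ((u 0 (lift ord0 b) *: 'X_b) \mPo power_sum_gen F N k) =
     fr (\sum_(b < N) (u 0 (lift ord0 b))%:P%:MP * \sum_j y j * tau j ^+ b.+1) / fr x0.
    rewrite rmorph_sum mulr_suml; apply: eq_bigr => b _.
    rewrite comp_mpolyZ comp_mpolyXU -tnth_nth /ev /= mmapZ.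
    by rewrite -[mmap _ _ _]/(ev _) evG [fr (_ * _)]rmorphM mulrA.
  rewrite -mulrDl -rmorphD; congr (fr _ / _).
  rewrite x0E mulr_sumr; under [X in _ + X]eq_bigr do rewrite mulr_sumr.
  rewrite exchange_big -big_split /=; apply: eq_bigr => j _.
  rewrite /genval big_ord_recl mul0n expr0 alg_polyC mpolyCD mulrDr mulrC; congr (_ + _).
  rewrite raddf_sum mulr_sumr; apply: eq_bigr => b _ /=.
  rewrite -mul_polyC mpolyCM mulrCA /tau; congr (_ * (_ * _)).
  by rewrite -rmorphXn /= -exprM mulnC.
pose t i : P := \prod_j phi (Some (i, j)).
have evT i : ev (T i \mPo power_sum_gen F N k) = fr (t i) / fr x0 ^+ d.
  rewrite /T /t rmorph_prod rmorph_prod [fr _]rmorph_prod.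
  have -> : fr x0 ^+ d = \prod_(j < d) fr x0 by rewrite prodr_const card_ord.
  rewrite -prodf_div; apply: eq_bigr => j _.
  by rewrite -evL affform_form_vec.
move=> H H0; apply/negP => /eqP /(congr1 ev).
rewrite rmorph0 comp_mpolyE rmorph_sum.
pose M := msize H.
(* Multiplying by [x0 ^+ (d * M)] clears all denominators and leaves this exponent on the form at
   infinity. In the difference of two terms [M] cancels, which leaves the weight [- d] of
   [form_weight]. *)
pose e (n : 'X_{1..r}) (o : option ('I_r * 'I_d)) : nat :=
  if o is Some ij then n ij.1 else (d * (M - mdeg n))%N.
have prodE n : \prod_o phi o ^+ e n o = x0 ^+ (d * (M - mdeg n)) * \prod_i t i ^+ n i.
  rewrite (bigD1 None) //=; congr (_ * _).
  rewrite (reindex_omap Some id) /=; last by case.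
  under eq_bigl do rewrite eqxx.
  rewrite -(pair_bigA _ (fun i j => phi (Some (i, j)) ^+ n i)) /=.
  by apply: eq_bigr => i _; rewrite /t -prodrXl.
have termE n : n \in msupp H ->
    ev (H@_n *: \prod_(i < r) tnth [tuple T i0 \mPo power_sum_gen F N k | i0 < r] i ^+ n i)
    = fr ((H@_n)%:P *: \prod_o phi o ^+ e n o) / fr x0 ^+ (d * M).
  move=> nH; rewrite /ev /= mmapZ -/(ev _) rmorph_prod -mul_mpolyC rmorphM -mulrA.
  congr (_ * _); rewrite prodE rmorphM rmorphXn rmorph_prod.
  have hM : (mdeg n <= M)%N by apply: ltnW; apply: msize_mdeg_lt.
  transitivity ((\prod_i fr (t i ^+ n i)) / fr x0 ^+ (d * mdeg n)).
    rewrite mdegE big_distrr /= -prodrXr -prodf_div; apply: eq_bigr => i _.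
    by rewrite rmorphXn tnth_mktuple /= evT expr_div_n -exprM -rmorphXn.
  have -> : fr x0 ^+ (d * M) = fr x0 ^+ (d * (M - mdeg n)) * fr x0 ^+ (d * mdeg n).
    by rewrite -exprD -mulnDr subnK.
  by rewrite invfM mulrACA (divff (expf_neq0 _ fx0)) mul1r.
rewrite big_seq (eq_bigr _ termE) -big_seq -mulr_suml -rmorph_sum => /eqP.
rewrite mulf_eq0 invr_eq0 expf_eq0 (negPf fx0) andbF orbF -(rmorph0 fr) (inj_eq fr_inj).
apply/negP; apply: sum_mlead_inj_neq0.
- by rewrite msupp_eq0.
- exact: msupp_uniq.
- move=> n; rewrite mcoeff_msupp => Hn.
  rewrite -mul_mpolyC mulf_neq0 ?mpolyC_eq0 ?polyC_eq0 //.
  by apply/prodf_neq0 => o _; apply: expf_neq0; apply: phi0.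
move=> n n' nH n'H /=.
rewrite !mleadZ ?polyC_eq0 -?mcoeff_msupp // => hlead.
pose dn : 'rV[int]_r := \row_i ((n i)%:Z - (n' i)%:Z).
have /lead_inj : forall o, (dn *m form_weight o) 0 0 = (e n o)%:Z - (e n' o)%:Z.
  case=> [[i j]|] /=; first by rewrite -colE !mxE.
  have hM a : a \in msupp H -> (mdeg a <= M)%N by move=> ?; apply: ltnW; apply: msize_mdeg_lt.
  rewrite mxE; under eq_bigr do rewrite !mxE.
  rewrite -mulr_suml sumrB -!(big_morph Posz PoszD (erefl _)) -!mdegE.
  by rewrite !PoszM -!subzn ?hM //; ring.
move=> /(_ hlead) /rowP dn0; apply/mnmP => i; have := dn0 i; rewrite !mxE => /eqP.
by rewrite subr_eq0 => /eqP [].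
Qed.

End Specialization.

(** * Reduction to a transcendence basis *)

Section AlgebraicDependence.
Variables (F : fieldType) (N r : nat) (S : 'I_r -> {mpoly F[N]}).
Let iota : {rmorphism {mpoly F[r]} -> {mpoly F[N]}} := comp_mpoly [tuple S i | i < r].

(** For independent [S] this is algebraicity over the fraction field, phrased without fractions:
    some nonzero multiple is integral. Closure under sums and products then follows from that of
    integral elements. *)
Definition algebraic_over (y : {mpoly F[N]}) :=
  exists2 a, a != 0 & integralOver iota (iota a * y).

Lemma algebraic_overD x y :
  algebraic_over x -> algebraic_over y -> algebraic_over (x + y).
Proof.
move=> [a a0 ha] [b b0 hb]; exists (a * b); first by rewrite mulf_neq0.
rewrite rmorphM mulrDr; apply: integral_add.
  by rewrite mulrAC mulrC; apply: integral_mul => //; apply: integral_id.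
by rewrite -mulrA; apply: integral_mul => //; apply: integral_id.
Qed.

Lemma algebraic_overM x y :
  algebraic_over x -> algebraic_over y -> algebraic_over (x * y).
Proof.
move=> [a a0 ha] [b b0 hb]; exists (a * b); first by rewrite mulf_neq0.
by rewrite rmorphM mulrACA; apply: integral_mul.
Qed.

Lemma algebraic_over_image a : algebraic_over (iota a).
Proof.
by exists 1; rewrite ?oner_eq0 // rmorph1 mul1r; apply: integral_id.
Qed.

Lemma algebraic_over_comp M (C : {mpoly F[M]}) (T : 'I_M -> {mpoly F[N]}) :
  (forall i, algebraic_over (T i)) -> algebraic_over (C \mPo [tuple T i | i < M]).
Proof.
move=> hT; have a0 : algebraic_over 0 by rewrite -(rmorph0 iota); apply: algebraic_over_image.
have a1 : algebraic_over 1 by rewrite -(rmorph1 iota); apply: algebraic_over_image.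
rewrite comp_mpolyE; apply: (@big_ind _ algebraic_over) => //; first exact: algebraic_overD.
move=> m _; rewrite -mul_mpolyC; apply: algebraic_overM.
  by have := algebraic_over_image (C@_m)%:MP; rewrite /= comp_mpolyC.
apply: (@big_ind _ algebraic_over) => //; first exact: algebraic_overM.
move=> i _; rewrite tnth_mktuple; elim: (m i) => [|k IHk]; first by rewrite expr0.
by rewrite exprS; apply: algebraic_overM.
Qed.

(** Divide [p] by ['X] until its constant term [c] is nonzero; the equation at [z] then exhibits
    [iota c] as a multiple of [z]. *)
Lemma root_dvd_constant (p : {poly {mpoly F[r]}}) (z : {mpoly F[N]}) :
  p != 0 -> z != 0 -> root (map_poly iota p) z ->
  exists2 c, c != 0 & exists y, iota c = z * y.
Proof.
move=> + z0; elim/poly_ind: p => [|p c IHp]; first by rewrite eqxx.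
case: (eqVneq c 0) => [->|c0] pn0; rewrite /root rmorphD rmorphM /= map_polyX map_polyC /=.
  rewrite (rmorph0 iota) addr0 hornerM hornerX mulf_eq0 (negPf z0) orbF; apply: IHp.
  by move: pn0; rewrite addr0; apply: contraNneq => ->; rewrite mul0r.
rewrite hornerD hornerM hornerX hornerC addrC addr_eq0 => /eqP h; exists c => //.
by exists (- (map_poly iota p).[z]); rewrite h mulrN mulrC.
Qed.

(** Reduces nonvanishing of [y] under a substitution to independence of the image of [S]: if [y]
    went to zero, so would [iota c]. *)
Lemma algebraic_over_dvd y : y != 0 -> algebraic_over y -> alg_indep S ->
  exists2 c, c != 0 & exists z, iota c = y * z.
Proof.
move=> y0 [a a0 [p monp rp]] indS.
have [||c c0 [z hz]] := root_dvd_constant _ _ rp.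
- exact: monic_neq0.
- by rewrite mulf_neq0 //; apply: indS.
by exists c => //; exists (iota a * z); rewrite hz mulrCA mulrA.
Qed.

Lemma algebraic_over_root (p : {poly {mpoly F[r]}}) (y : {mpoly F[N]}) :
  alg_indep S -> p != 0 -> root (map_poly iota p) y -> algebraic_over y.
Proof.
move=> indS p0 /rootP; set a := lead_coef p.
have a0 : a != 0 by rewrite lead_coef_eq0.
have := polySpred p0; set n := (size p).-1 => sp.
have -> : (map_poly iota p).[y] = \sum_(i < n.+1) iota p`_i * y ^+ i.
  rewrite (@horner_coef_wide _ n.+1); last by rewrite -sp size_poly.
  by apply: eq_bigr => i _; rewrite coef_map.
have an : p`_n = a by rewrite /a lead_coefE.
rewrite big_ord_recr /= an.
case: n sp an => [|n] sp an.
  rewrite big_ord0 add0r expr0 mulr1 => /eqP.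
  by rewrite (negPf (indS _ a0)).
move=> py; exists a => //.
(* Here [p] has degree [n + 1]. Multiplying its equation by [a ^+ n] turns it into a monic one for
   [iota a * y]. *)
pose q := \poly_(i < n.+1) (p`_i * a ^+ (n - i)).
exists ('X^(n.+1) + q).
  rewrite monicE lead_coefDl ?lead_coefXn // size_polyXn ltnS; exact: size_poly.
apply/rootP; rewrite rmorphD /= map_polyXn hornerD hornerXn.
have -> : (map_poly iota q).[iota a * y] =
    \sum_(i < n.+1) iota (p`_i * a ^+ (n - i)) * (iota a * y) ^+ i.
  rewrite (@horner_coef_wide _ n.+1); last first.
    by apply: leq_trans (size_poly _ _) _; apply: size_poly.
  by apply: eq_bigr => i _; rewrite coef_map coef_poly ltn_ord.
transitivity (iota a ^+ n *
    (\sum_(i < n.+1) iota p`_i * y ^+ i + iota a * y ^+ n.+1)); last first.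
  by rewrite py mulr0.
rewrite mulrDr addrC; congr (_ + _); last by rewrite exprMn exprSr mulrA.
rewrite mulr_sumr; apply: eq_bigr => i _.
rewrite rmorphM rmorphXn exprMn !mulrA; congr (_ * _).
by rewrite -mulrA -exprD subnK -1?ltnS // mulrC.
Qed.

End AlgebraicDependence.

(** Every coefficient of [H] is recovered from [muni H], so a nonzero relation stays nonzero when
    read as a polynomial in its last variable. *)
Lemma coef_muni (F : fieldType) (r : nat) (H : {mpoly F[r.+1]}) (m : 'X_{1..r.+1}) :
  ((muni H)`_(m ord_max))@_[multinom m (widen_ord (leqnSn r) i) | i < r] = H@_m.
Proof.
rewrite muniE coef_sum raddf_sum /= [in RHS](mpolyE H) raddf_sum /=.
apply: eq_bigr => m' _; rewrite !coefZ coefXn mcoeffZ mcoeffX.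
case: (eqVneq (m ord_max) (m' ord_max)) => [eqm|neqm]; last first.
  rewrite mulr0 mcoeff0 (_ : (m' == m) = false) ?mulr0 //; apply/negbTE.
  by apply: contra neqm => /eqP ->.
rewrite mulr1 mcoeffZ mcoeffX; congr (_ * _%:R); congr (nat_of_bool _).
apply/eqP/eqP => [/mnmP h|->] //; apply/mnmP => i.
case: (unliftP ord_max i) => [j ->|->] //.
have := h j; rewrite !mnmE (_ : lift ord_max j = widen_ord (leqnSn r) j) //.
by apply: val_inj; apply: lift_max.
Qed.

Lemma horner_muni (F : fieldType) (N r : nat) (S : 'I_r -> {mpoly F[N]})
    (y : {mpoly F[N]}) (H : {mpoly F[r.+1]}) :
  (map_poly (comp_mpoly [tuple S i | i < r]) (muni H)).[y] =
  H \mPo [tuple (if unlift ord_max i is Some j then S j else y) | i < r.+1].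
Proof.
rewrite muniE rmorph_sum horner_sum comp_mpolyE; apply: eq_bigr => m _.
rewrite -mul_polyC rmorphM /= map_polyC map_polyXn hornerM hornerC hornerXn.
rewrite /= comp_mpolyZ comp_mpolyX -scalerAl; congr (_ *: _).
rewrite big_ord_recr /= tnth_mktuple unlift_none; congr (_ * _).
apply: eq_bigr => i _; rewrite !tnth_mktuple mnmE.
rewrite (_ : widen_ord _ i = lift ord_max i) ?liftK //.
by apply: val_inj; apply: esym; apply: lift_max.
Qed.

Lemma algebraic_over_dependent (F : fieldType) (N r : nat) (S : 'I_r -> {mpoly F[N]})
    (y : {mpoly F[N]}) : alg_indep S ->
  ~ alg_indep (fun i : 'I_r.+1 => if unlift ord_max i is Some j then S j else y) ->
  algebraic_over S y.
Proof.
move=> indS dep; have [H hH] := not_all_ex_not _ _ dep.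
have [H0 /negP] := imply_to_and _ _ hH; rewrite negbK => /eqP HSy.
apply: (@algebraic_over_root _ _ _ _ (muni H)) => //; last by rewrite /root horner_muni HSy.
apply: contraNneq H0 => mH; apply/eqP/mpolyP => m.
by rewrite -coef_muni mH coef0 !mcoeff0.
Qed.

Lemma alg_indep0 (F : fieldType) (N : nat) (S : 'I_0 -> {mpoly F[N]}) : alg_indep S.
Proof.
move=> H; have -> : H = (H@_0)%:MP.
  by apply/mpolyP => m; rewrite nvar0_mnmE mcoeffC eqxx mulr1.
by rewrite comp_mpolyC !mpolyC_eq0.
Qed.

(** Otherwise every independent subfamily could be enlarged, up to [k + 1] members. A new index is
    never one already chosen, as chosen members are algebraic over the family. *)
Lemma exists_transcendence_basis (F : fieldType) (N M k : nat)
    (T : 'I_M -> {mpoly F[N]}) : trdeg_le T k ->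
  exists (r : nat) (f : 'I_r -> 'I_M), [/\ (r <= k)%N, alg_indep (T \o f) &
    forall i, algebraic_over (T \o f) (T i)].
Proof.
move=> trT; apply: NNPP => hn.
have all_r r : exists2 f : 'I_r -> 'I_M, injective f & alg_indep (T \o f).
  elim: r => [|r [f injf indf]].
    by exists (fun i : 'I_0 => match notF (ltn_ord i) with end) => [[]//|]; apply: alg_indep0.
  apply: NNPP => hn'; apply: hn; exists r, f; split=> //; first exact: trT injf indf.
  move=> i; case: (classic (exists j, f j = i)) => [[j <-]|hi].
    have := @algebraic_over_image _ _ _ (T \o f) 'X_j.
    by rewrite /= comp_mpolyXU -tnth_nth tnth_mktuple.
  apply: algebraic_over_dependent => // ind; apply: hn'.
  exists (fun a => if unlift ord_max a is Some j then f j else i).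
    move=> a b; case: (unliftP ord_max a) => [a' ->|->];
      case: (unliftP ord_max b) => [b' ->|->] //.
    - by move/injf ->.
    - by move=> fa; case: hi; exists a'.
    - by move=> fb; case: hi; exists b'.
  move=> H /ind; set t1 := [tuple _ | _ < _]; set t2 := [tuple _ | _ < _].
  suff -> : t2 = t1 by []; apply: eq_from_tnth => a.
  by rewrite !tnth_mktuple /=; case: unlift.
have [f injf indf] := all_r k.+1.
by have := trT _ _ injf indf; rewrite ltnn.
Qed.

Lemma comp_mpolyA (F : fieldType) (n N m : nat) (p : {mpoly F[n]})
    (S : 'I_n -> {mpoly F[N]}) (G : N.-tuple {mpoly F[m]}) :
  (p \mPo [tuple S i | i < n]) \mPo G = p \mPo [tuple S i \mPo G | i < n].
Proof.
rewrite [p \mPo [tuple S i | i < n]]comp_mpolyE raddf_sum [RHS]comp_mpolyE.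
apply: eq_bigr => a _.
rewrite /= comp_mpolyZ rmorph_prod; congr (_ *: _); apply: eq_bigr => i _.
by rewrite rmorphXn !tnth_mktuple.
Qed.

(** A nonzero [Q] is algebraic over a transcendence basis, so it divides a nonzero polynomial in
    that basis, which the generator does not kill. *)
Lemma power_sum_gen_generator (F : fieldType) (e k d n : nat) :
  generator_for (power_sum_gen F (2 ^ n) k) (@in_class F e k d n).
Proof.
move=> Q [M [C [L [_ degL trT QE]]]]; split; last first.
  by apply: contraNneq => ->; rewrite comp_mpoly0.
move=> Q0; have [r [f [rk indf algT]]] := exists_transcendence_basis trT.
have algQ : algebraic_over (fun i => \prod_(j < d) L (f i) j) Q.
  by rewrite QE; apply: algebraic_over_comp.
have [c c0 [z /= cz]] := algebraic_over_dvd Q0 algQ indf.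
have /(_ c c0) := power_sum_gen_indep (fun i j => degL (f i) j) indf rk.
by rewrite -comp_mpolyA cz rmorphM /=; apply: contraNneq => ->; rewrite mul0r.
Qed.

(** * Succinctness *)

Lemma set_index_lt (n : nat) (S : {set 'I_n}) : (set_index S < 2 ^ n)%N.
Proof.
have h p : (\sum_(i < p) 2 ^ i < 2 ^ p)%N.
  elim: p => [|p IHp]; first by rewrite big_ord0.
  by rewrite big_ord_recr /= expnS mul2n -addnn -addSn leq_add2r.
apply: leq_ltn_trans (h n); rewrite /set_index big_mkcond /=.
by apply: leq_sum => i _; case: ifP.
Qed.

Definition kronecker_factor (F : fieldType) (n : nat) (t : F) (l : 'I_n) : aff_form F n :=
  (1, [ffun i => if i == l then t ^+ (2 ^ l) else 0]).

Definition kronecker_gate (F : fieldType) (n : nat) (z t : F) : seq (aff_form F n) :=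
  (z, [ffun => 0]) :: [seq kronecker_factor t l | l <- enum 'I_n].

Lemma aff_eval_kronecker_factor (F : fieldType) (n : nat) (t : F) (l : 'I_n) :
  aff_eval (kronecker_factor t l) = 1 + t ^+ (2 ^ l) *: 'X_l.
Proof.
rewrite /aff_eval /= mpolyC1 (bigD1 l) //= ffunE eqxx big1 ?addr0 // => i il.
by rewrite ffunE (negPf il) scale0r.
Qed.

(** Expanding the product over subsets, the powers [t^(2^l)] for [l] in [S] multiply to [t] to the
    binary index of [S]. *)
Lemma eval_kronecker_gate (F : fieldType) (n : nat) (z t : F) :
  \prod_(a <- kronecker_gate n z t) aff_eval a =
  \sum_(S : {set 'I_n}) (z * t ^+ set_index S) *: xS F S.
Proof.
rewrite big_cons big_map big_enum /=.
under eq_bigr do rewrite aff_eval_kronecker_factor addrC.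
rewrite bigA_distr.
have -> : aff_eval (z, [ffun=> 0]) = z%:MP_[n].
  by rewrite /aff_eval /= big1 ?addr0 // => i _; rewrite ffunE scale0r.
rewrite mul_mpolyC scaler_sumr; apply: eq_bigr => S _.
rewrite -big_mkcond /= scaler_prod -scalerA; congr (_ *: (_ *: _)).
by rewrite /set_index -prodrXr.
Qed.

Lemma multilinear_kronecker (F : fieldType) (n : nat) (s : seq (F * F)) :
  sps_multilinear [seq kronecker_gate n p.1 p.2 | p <- s].
Proof.
move=> _ /mapP [[z t] _ ->]; rewrite /kronecker_gate.
move: (enum _) (enum_uniq 'I_n) => es ues j1 j2 /=; rewrite size_map.
case: j1 => [|j1] h1; first by left; rewrite ffunE.
case: j2 => [|j2] h2; first by right; rewrite ffunE.
move=> j12 i; rewrite /= !(nth_map i) // !ffunE.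
case: eqVneq => [e1|]; last by left.
right; case: eqVneq => // e2; case/negP: j12.
by rewrite eqSS -(nth_uniq i _ _ ues) // -e1 -e2.
Qed.

(** Each gate costs one for itself, one for the constant form [z], and at most two for each of the
    [n] factors. *)
Lemma size_kronecker (F : fieldType) (n : nat) (s : seq (F * F)) :
  (sps_size [seq kronecker_gate n p.1 p.2 | p <- s] <= 1 + size s * (2 + 2 * n))%N.
Proof.
rewrite /sps_size leq_add2l big_map; elim: s => [|[z t] s IHs]; first by rewrite big_nil.
rewrite big_cons [size _]/= mulSn; apply: leq_add => //.
rewrite /kronecker_gate big_cons big_map big_enum /=.
rewrite (_ : [set i | _] = set0) ?cards0; last first.
  by apply/setP => i; rewrite !inE ffunE eqxx.
rewrite addn0 addnA leq_add2l; apply: (@leq_trans (\sum_(i < n) 2)); last first.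
  by rewrite sum_nat_const card_ord mulnC.
apply: leq_sum => l _; rewrite add1n ltnS -(cards1 l); apply: subset_leq_card.
by apply/subsetP => i; rewrite !inE ffunE; case: (i == l); rewrite ?eqxx.
Qed.

Lemma power_sum_gen_succinct (F : fieldType) (n k : nat) :
  sps_succinct (power_sum_gen F (2 ^ n) k) (1 + k.+1 * (2 + 2 * n)).
Proof.
move=> alpha.
pose s := [seq (alpha (lshift _ j), alpha (rshift _ j)) | j <- enum 'I_k.+1].
exists [seq kronecker_gate n p.1 p.2 | p <- s]; split.
- exact: multilinear_kronecker.
- by apply: leq_trans (size_kronecker _ _) _; rewrite size_map size_enum_ord.
rewrite /sps_eval big_map /s big_map big_enum /=.
under eq_bigr do rewrite eval_kronecker_gate.
rewrite exchange_big /=; apply: eq_bigr => S _; rewrite -scaler_suml; congr (_ *: _).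
have -> : nth 0 (power_sum_gen F (2 ^ n) k) (set_index S) =
    tnth (power_sum_gen F (2 ^ n) k) (Ordinal (set_index_lt S)) by rewrite (tnth_nth 0).
rewrite tnth_mktuple raddf_sum; apply: eq_bigr => j _ /=.
by rewrite rmorphM rmorphXn /= !mevalXU.
Qed.

(* poly(N) degree bound on C is N^e; poly(k,n) size bound is c*(k+n)^c,
   with c depending only on e (not on F, k, d, n). *)
Theorem theorem4p9 :
  forall e : nat, exists c : nat,
  forall (F : fieldType) (k d n : nat),
    (0 < k)%N -> (0 < d)%N -> (0 < n)%N ->
    (forall p : nat, p \in [pchar F] -> (d ^ k <= p)%N) ->
    exists (m : nat) (G : (2 ^ n).-tuple {mpoly F[m]}),
      sps_succinct G (c * (k + n) ^ c) /\
      generator_for G (@in_class F e k d n).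
Proof.
(* As [k + 1 <= k + n] and [2 + 2n <= 4(k + n)], the size is at most [1 + 4(k + n)^2 <= 5(k + n)^2];
   the same [5] also bounds the exponent. *)
move=> e; exists 5%N => F k d n k0 d0 n0 _.
exists (k.+1 + k.+1)%N, (power_sum_gen F (2 ^ n) k); split; last first.
  exact: power_sum_gen_generator.
move=> alpha; have [f [ml sz ev]] := power_sum_gen_succinct n alpha.
exists f; split=> //; apply: leq_trans sz _.
apply: (@leq_trans (5 * (k + n) ^ 2)); last by rewrite leq_mul2l leq_pexp2l // addn_gt0 k0.
have hk : (k.+1 <= k + n)%N by rewrite -addn1 leq_add2l.
have hn : (2 + 2 * n <= 4 * (k + n))%N by lia.
have hm := leq_mul hk hn.
rewrite mulSn leq_add ?expn_gt0 ?addn_gt0 ?k0 //.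
by apply: leq_trans hm _; rewrite -mulnn mulnCA.
Qed.
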